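(* Let $\{\varphi_i\}_{1<i<n}$ be a dual equivalence for $(\mathcal{A},\mathrm{Des})$ and let $\mathrm{stat}:\mathcal{A}\to\mathbb{Z}_{\ge0}$ (or to $\mathbb{Z}_{\ge0}^r$, with $q^{\mathrm{stat}}$ the corresponding monomial) satisfy $\mathrm{stat}(\varphi_i(T))=\mathrm{stat}(T)$ for all $i$ and $T$. Then each equivalence class of the relation generated by all $\varphi_i$ contains a unique dominant element, $\alpha(T)$ is a partition for every dominant $T$, and $$f(X;q):=\sum_{T\in\mathcal{A}}q^{\mathrm{stat}(T)}Q_{\mathrm{Des}(T)}(X)=\sum_{T\in\mathrm{Dom}(\mathcal{A})}q^{\mathrm{stat}(T)}s_{\alpha(T)}(X)=\sum_\lambda\Big(\sum_{T\in\mathrm{Dom}(\mathcal{A}),\ \alpha(T)=\lambda}q^{\mathrm{stat}(T)}\Big)s_\lambda(X),$$ where $\mathrm{Dom}(\mathcal{A})$ is the set of dominant elements.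
   Context: $\mathcal{A}$ is a finite set and $\mathrm{Des}(T)\subseteq[n-1]$ for $T\in\mathcal{A}$. For $D\subseteq[n-1]$, $Q_D(X)=\sum x_{i_1}\cdots x_{i_n}$ over $i_1\le\dots\le i_n$ with $i_j<i_{j+1}$ for $j\in D$; $s_\lambda$ is the Schur function. Dual equivalence: for $1<h\le i<n$, $[T]_{h,i}$ is the class of $T$ under the equivalence relation generated by $\varphi_h,\dots,\varphi_i$, and $\mathrm{Des}_{h,i}(U)=\{d-(h-2):d\in\mathrm{Des}(U)\cap\{h-1,\dots,i\}\}\subseteq[i-h+2]$. $\{\varphi_i\}$ (involutions on $\mathcal{A}$) is a dual equivalence if (i) for all $1<h\le i<n$ with $i-h\le3$ and all $T$, $\sum_{U\in[T]_{h,i}}Q_{\mathrm{Des}_{h,i}(U)}(X)=s_\lambda(X)$ for some partition $\lambda$ of $i-h+3$; (ii) $\varphi_i\varphi_j=\varphi_j\varphi_i$ for $|i-j|\ge3$. For $T\in\mathcal{A}$ with $\mathrm{Des}(T)=\{d_1<\dots<d_k\}$, $\alpha(T)$ is the composition $(d_1,d_2-d_1,\dots,d_k-d_{k-1},n-d_k)$ of $n$. Dominance on compositions of $n$: $\alpha\ge\beta$ iff $\alpha_1+\dots+\alpha_j\ge\beta_1+\dots+\beta_j$ for all $j$. $T$ is dominant if $\alpha(T)\ge\alpha(S)$ for every $S$ in the equivalence class of $T$ under the relation generated by all $\varphi_i$. *)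

(* Defs.v *)
From mathcomp Require Import all_boot.
Set Implicit Arguments. Unset Strict Implicit. Unset Printing Implicit Defensive.

(* Monomials of degree m in the variables x_0, x_1, ... are represented by
   weakly increasing index sequences w = (i_1 <= ... <= i_m) : seq nat.
   A homogeneous formal power series of degree m is determined by its
   coefficients at all such w. *)
Definition monomial (m : nat) (w : seq nat) : bool := sorted leq w && (size w == m).

(* Coefficient of the monomial w in Gessel's fundamental quasisymmetric
   function Q_D (D a subset of [size w - 1]): the unique weakly increasing
   index sequence with content w must be strict at every position j in D. *)
Definition Qcoeff (D : pred nat) (w : seq nat) : bool :=
  all (fun j => D j ==> (nth 0 w j.-1 < nth 0 w j)) (iota 1 (size w).-1).

(* Partitions: weakly decreasing sequences of naturals with the given sum
   (zero parts are allowed and are irrelevant). *)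
Definition is_partition (m : nat) (la : seq nat) : bool :=
  sorted geq la && (sumn la == m).

Definition col_strict (r1 r2 : seq nat) : bool :=
  (size r2 <= size r1) && all (fun j => nth 0 r1 j < nth 0 r2 j) (iota 0 (size r2)).
Definition is_ssyt (t : seq (seq nat)) : bool :=
  all (sorted leq) t && sorted col_strict t.

(* Coefficient of the monomial w in the Schur function s_la: the number of
   semistandard tableaux of shape la whose multiset of entries is w
   (a filling is a distinct rearrangement of w cut into rows of lengths la). *)
Definition schur_coeff (la : seq nat) (w : seq nat) : nat :=
  count (fun p => is_ssyt (reshape la p)) (permutations w).

Section DualEquivalence.
Variables (A : finType) (n : nat) (Des : A -> pred nat) (phi : nat -> A -> A).

Definition phi_rel (h i : nat) : rel A := fun U V =>
  [exists j : 'I_n, (h <= j <= i) && ((V == phi j U) || (U == phi j V))].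

Definition in_class (h i : nat) (T U : A) : bool := connect (phi_rel h i) T U.

Definition full_class (T U : A) : bool := in_class 2 n.-1 T U.

Definition Des_hi (h i : nat) (U : A) : pred nat :=
  fun d => (0 < d) && (d <= i - h + 2) && Des U (d + (h - 2)).

Definition is_dual_equivalence : Prop :=
  (forall i, 1 < i < n -> involutive (phi i)) /\
  (forall h i (T : A), 1 < h -> h <= i -> i < n -> i - h <= 3 ->
     exists la, is_partition (i - h + 3) la /\
       forall w, monomial (i - h + 3) w ->
         \sum_(U | in_class h i T U) Qcoeff (Des_hi h i U) w = schur_coeff la w) /\
  (forall i j, 1 < i < n -> 1 < j < n -> 3 <= (if i <= j then j - i else i - j) ->
     forall T, phi i (phi j T) = phi j (phi i T)).

End DualEquivalence.

Definition comp_of_des (n : nat) (D : pred nat) : seq nat :=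
  let s := [seq d <- iota 1 n.-1 | D d] in
  [seq p.2 - p.1 | p <- zip (0 :: s) (rcons s n)].

Definition dominates (a b : seq nat) : bool :=
  all (fun j => sumn (take j b) <= sumn (take j a)) (iota 0 (maxn (size a) (size b)).+1).

Definition dominant (A : finType) (n : nat) (Des : A -> pred nat) (phi : nat -> A -> A)
  (T : A) : bool :=
  [forall S, full_class n phi T S ==> dominates (comp_of_des n (Des T)) (comp_of_des n (Des S))].

(* Main.v *)
(** A standard tableau is encoded by its lattice word, whose [k]-th letter is the row of
    the entry [k]; descents become ascents of the word, and the elementary dual
    equivalence on the entries [i-1, i, i+1] becomes a Knuth move [dd i].  By induction on
    [k], every class under [phi 2, ..., phi (k-1)] is a copy of the graph of all lattice
    words of one content.  In the step, the row of the entry [k+1] is read off from which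
    elements of the class have a descent at [k].  The hypothesis that windows of degree at
    most 5 have Schur generating functions forces [phi k] to act as [dd k].  So a class under
    [phi 2, ..., phi k] covers the standard graph, and the covering is injective because its
    monodromy is generated by closed walks that involve only three corners and take place
    in a window of degree 6, where the Schur hypothesis leaves no room for a second sheet.
    Hence each full class has generating function [s_lambda], and its dominant element is
    the one whose lattice word is weakly increasing. *)

Require Import Defs.
From mathcomp Require Import all_boot zify.
Set Implicit Arguments. Unset Strict Implicit. Unset Printing Implicit Defensive.

(* [lia] becomes slow when boolean hypotheses that are not linear inequalities are in the context. *)
Ltac mlia := repeat match goal with H : ?Q |- _ =>
    lazymatch type of Q with Prop =>
      lazymatch Q with
      | @eq nat _ _ => fail
      | is_true (leq _ _) => fail
      | is_true (andb (leq _ _) (leq _ _)) => fail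
      | _ => clear H
      end
    end
  end; lia.

(** * Lattice words *)

(** The hypotheses do not say that [phi i] leaves distant descents alone. Windows of degree 5 give
    this at [i + 2] and [i - 3], and commutation carries it further, because [phi j] fixes an
    element exactly when its descents at [j - 1] and [j] agree. Rows are identified indirectly: an
    addable row is determined by the corners strictly above it ([addable_inj]), and comparing a
    letter with a corner amounts to a descent of a suitably rearranged element. The claim on [phi k]
    thus becomes a statement about a few bit vectors that must belong to tableaux of one shape, and
    it is checked by computation. A class under [phi 2, ..., phi k] splits into classes under
    [phi 2, ..., phi k.-1], each with a constant last letter, which is a corner. The exit from such
    a class towards a given other corner is unique, so a second sheet could only come from going
    round three corners. Exchanging three corners takes six letters, hence degree 6. Descent sets do
    not separate all tableaux of a shape there, and the loop is chosen to start at a descent set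
    that does. *)

Definition cnt (j : nat) (r : seq nat) : nat := count_mem j r.

Lemma cnt_rcons j r x : cnt j (rcons r x) = cnt j r + (x == j).
Proof. by rewrite /cnt -cats1 count_cat /= addn0. Qed.

Lemma cnt_cat j r s : cnt j (r ++ s) = cnt j r + cnt j s.
Proof. exact: count_cat. Qed.

Lemma cnt_cons j x r : cnt j (x :: r) = (x == j) + cnt j r.
Proof. by []. Qed.

Lemma cnt_nil j : cnt j [::] = 0.
Proof. by []. Qed.

Lemma cnt_perm r s : perm_eq r s -> forall j, cnt j r = cnt j s.
Proof. by move=> /permP rs j; apply: rs. Qed.

Lemma perm_cnt r s : (forall j, cnt j r = cnt j s) -> perm_eq r s.
Proof. by move=> rs; apply/allP => j _; apply/eqP/rs. Qed.

Arguments cnt : simpl never.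

(* A cell can be added in row [c] (rows are numbered from 0) to the shape with row lengths [cnt j r]. *)
Definition addable (r : seq nat) (c : nat) : bool :=
  (c == 0) || (cnt c r < cnt c.-1 r).

Definition yam (r : seq nat) : bool :=
  all (fun k => addable (take k r) (nth 0 r k)) (iota 0 (size r)).

Lemma yam_rcons r c : yam (rcons r c) = yam r && addable r c.
Proof.
rewrite /yam size_rcons -addn1 iotaD all_cat /= andbT add0n; congr (_ && _).
  apply: eq_in_all => k; rewrite mem_iota add0n => /andP[_ lt_k].
  by rewrite nth_rcons lt_k -cats1 takel_cat ?(ltnW lt_k).
by rewrite nth_rcons ltnn eqxx -cats1 take_size_cat.
Qed.

Lemma yam_catl u v : yam (u ++ v) -> yam u.
Proof.
by elim/last_ind: v => [|v x IH]; rewrite ?cats0 // -rcons_cat yam_rcons => /andP[/IH].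
Qed.

Lemma addable_perm r s c : perm_eq r s -> addable r c = addable s c.
Proof. by move=> /cnt_perm rs; rewrite /addable !rs. Qed.

(** Whether a letter may be appended depends only on the content of what precedes it. *)
Lemma yam_cat_perm u v t : perm_eq u v -> yam v -> yam (u ++ t) -> yam (v ++ t).
Proof.
move=> uv yv; elim/last_ind: t => [|t x IH]; rewrite ?cats0 // -!rcons_cat !yam_rcons.
move=> /andP[/IH-> /=]; rewrite (@addable_perm (u ++ t) (v ++ t)) //.
by rewrite perm_cat2r.
Qed.

Lemma yam_cnt r j : yam r -> cnt j.+1 r <= cnt j r.
Proof.
elim/last_ind: r => [|r x IH] //; rewrite yam_rcons /addable => /andP[/IH IHj xr].
rewrite !cnt_rcons; case: (eqVneq x j.+1) xr => [->|_] /=; last lia.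
by case: eqP => [/esym/n_Sn|_] //=; lia.
Qed.

(** A nonempty row forces all rows above it to be nonempty. The bound justifies the range of letters
    in [allyam]. *)
Lemma addable_le_size r c : yam r -> addable r c -> c <= size r.
Proof.
move=> yr; have lt_size: forall k, 0 < cnt k r -> k < size r.
  elim/last_ind: r yr => [|r x IH] //.
  rewrite yam_rcons => /andP[yr xr] k; rewrite cnt_rcons size_rcons.
  case: (eqVneq x k) => [<- _|_]; last by rewrite addn0 => /(IH yr)/leqW.
  move: xr; rewrite /addable; case: (x) => //= x' lt; rewrite ltnS.
  by have/(IH yr) : 0 < cnt x' r by lia.
rewrite /addable; case: c => //= c lt.
by apply: lt_size; lia.
Qed.

(** Built letter by letter so that the checks in degrees up to 6 run by [vm_compute]. *)
Fixpoint allyam m : seq (seq nat) :=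
  if m is m'.+1 then
    [seq rcons r x | r <- allyam m', x <- [seq x <- iota 0 m | addable r x]]
  else [:: [::]].

Lemma allyamS m :
  allyam m.+1 = [seq rcons r x | r <- allyam m, x <- [seq x <- iota 0 m.+1 | addable r x]].
Proof. by []. Qed.

Lemma mem_allyam m r : (r \in allyam m) = yam r && (size r == m).
Proof.
elim: m r => [|m IH] r; first by case: r => [|x r] /=; rewrite ?inE ?andbF.
rewrite allyamS.
apply/allpairsPdep/idP => [[s [x []]]|].
  rewrite IH => /andP[ys /eqP ss]; rewrite mem_filter => /andP[ax _] ->.
  by rewrite yam_rcons ys ax size_rcons ss /=.
case/lastP: r => [|r x] //; rewrite yam_rcons size_rcons eqSS => /andP[/andP[yr ax] /eqP sr].
exists r, x; split=> //; first by rewrite IH yr sr /=.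
have lex := addable_le_size yr ax.
by rewrite mem_filter ax mem_iota -sr /= add0n ltnS.
Qed.

Lemma uniq_allyam m : uniq (allyam m).
Proof.
elim: m => [|m IH] //; rewrite allyamS.
apply: allpairs_uniq_dep => //.
  by move=> r _; apply: filter_uniq; apply: (iota_uniq 0 m.+1).
by move=> [r x] [s y] _ _ /= /rcons_inj[-> ->].
Qed.

(* The Knuth move on the letters [i-1], [i], [i+1] (counted from 1). *)
Definition dd (i : nat) (r : seq nat) : seq nat :=
  take (i - 2) r ++
  match drop (i - 2) r with
  | [:: x, y, z & t] =>
      if (x < y) == (y < z) then [:: x, y, z & t]
      else if (x < z) == (x < y) then [:: y, x, z & t] else [:: x, z, y & t]
  | t => t
  end.

Lemma dd_cat i u x y z t : size u = i - 2 ->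
  dd i (u ++ [:: x, y, z & t]) =
    if (x < y) == (y < z) then u ++ [:: x, y, z & t]
    else if (x < z) == (x < y) then u ++ [:: y, x, z & t] else u ++ [:: x, z, y & t].
Proof.
move=> su; rewrite /dd -su take_size_cat // drop_size_cat //.
by case: ifP => //; case: ifP.
Qed.

Lemma split3 i (r : seq nat) : 1 < i < size r ->
  exists u x y z t, r = u ++ [:: x, y, z & t] /\ size u = i - 2.
Proof.
move=> /andP[i1 ir]; exists (take (i - 2) r).
have := cat_take_drop (i - 2) r; have: size (drop (i - 2) r) = size r - (i - 2) by rewrite size_drop.
case: (drop _ _) => [|x [|y [|z t]]] /= sd e; try lia.
exists x, y, z, t; split=> //; rewrite size_takel //; lia.
Qed.

Lemma perm_swap u (x y : nat) t : perm_eq (u ++ [:: x, y & t]) (u ++ [:: y, x & t]).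
Proof. by rewrite perm_cat2l (perm_catCA [:: x] [:: y]). Qed.

Lemma perm_dd i r : perm_eq (dd i r) r.
Proof.
rewrite -{2}(cat_take_drop (i - 2) r) /dd perm_cat2l.
case: (drop _ _) => [|x [|y [|z t]]] //.
case: ifP => // _; case: ifP => _; first exact: (perm_swap [::]).
exact: (perm_swap [:: x]).
Qed.

Lemma size_dd i r : size (dd i r) = size r.
Proof. exact/perm_size/perm_dd. Qed.

Lemma dd_rcons i r c : 1 < i < size r -> dd i (rcons r c) = rcons (dd i r) c.
Proof.
move=> /split3[u [x [y [z [t [-> su]]]]]].
by rewrite -!cats1 -catA /= !dd_cat //; do 2?case: ifP => _; rewrite -catA.
Qed.

Lemma addable_weaken u x c : x != c -> addable u c -> addable (rcons u x) c.
Proof.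
rewrite /addable !cnt_rcons => /negPf->; case: eqP => //= _; rewrite addn0 => lt.
exact: leq_trans lt (leq_addr _ _).
Qed.

Lemma addable_strengthen u x c : x.+1 != c -> addable (rcons u x) c -> addable u c.
Proof.
case: c => // c; rewrite eqSS /addable !cnt_rcons /= => /negPf->; rewrite addn0.
by apply: leq_ltn_trans; apply: leq_addr.
Qed.

Lemma yam_dd i r : 1 < i < size r -> yam r -> yam (dd i r).
Proof.
move=> /split3[u [x [y [z [t [-> su]]]]]] yr; rewrite dd_cat //.
have yu := yam_catl yr.
have: yam (rcons (rcons (rcons u x) y) z).
  apply: (@yam_catl _ t); rewrite -!cats1 -!catA; exact: yr.
rewrite !yam_rcons yu /= => /andP[/andP[ax ay] az].
have assoc3 a b c : u ++ [:: a, b, c & t] = (u ++ [:: a; b; c]) ++ t by rewrite -catA.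
have e3 a b c : u ++ [:: a; b; c] = rcons (rcons (rcons u a) b) c by rewrite -!cats1 -!catA.
case: ifP => // npq; case: ifP => s; rewrite assoc3.
  have p3 : perm_eq (u ++ [:: x; y; z]) (u ++ [:: y; x; z]) by apply: perm_swap.
  apply: (yam_cat_perm p3); last by rewrite -assoc3.
  rewrite e3 !yam_rcons yu /=; apply/andP; split; last first.
    by rewrite -(addable_perm z (_ : perm_eq (rcons (rcons u x) y) _)) // -!cats1 -!catA perm_swap.
  apply/andP; split; last by apply: addable_weaken => //; lia.
  case: (eqVneq x.+1 y) => [e|]; last by move/addable_strengthen; apply.
  have e' : z = y by lia.
  by move: az; rewrite e' -e /addable !cnt_rcons /= eqxx; lia.
have p3 : perm_eq (u ++ [:: x; y; z]) (u ++ [:: x; z; y]).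
  by rewrite perm_cat2l perm_cons; apply: (perm_swap [::]).
apply: (yam_cat_perm p3); last by rewrite -assoc3.
rewrite e3 !yam_rcons yu ax /=; apply/andP; split; last by apply: addable_weaken => //; lia.
(* Here the Knuth condition forces [x = y], and after a lattice word [u] and this [x] the letter
   [y + 1] is always addable. *)
case: (eqVneq y.+1 z) => [e|]; last by move/addable_strengthen; apply.
have e' : x = y by lia.
rewrite e' -e /addable !cnt_rcons /= eqxx; have -> : (y == y.+1) = false by lia.
by rewrite addn0 addn1 ltnS; apply: yam_cnt.
Qed.

Definition partc (r : seq nat) : Prop := forall j, cnt j.+1 r <= cnt j r.

Lemma yam_partc r : yam r -> partc r.
Proof. by move=> yr j; apply: yam_cnt. Qed.

Lemma cnt_rem g w : g \in w -> forall j, cnt j w = cnt j (rem g w) + (g == j).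
Proof.
by move=> /perm_to_rem/cnt_perm gw j; rewrite gw cnt_cons addnC.
Qed.

Lemma cnt_gt0 g w : (0 < cnt g w) = (g \in w).
Proof. by rewrite /cnt -has_count has_pred1. Qed.

Lemma partc_rem g w : partc w -> cnt g.+1 w < cnt g w -> partc (rem g w).
Proof.
move=> pw gw j; have gin : g \in w by rewrite -cnt_gt0; lia.
have := pw j; rewrite !(cnt_rem gin); move: gw; rewrite !(cnt_rem gin).
by case: (eqVneq g j) => [->|?]; lia.
Qed.

Lemma addable_rem g w : partc w -> g \in w -> addable (rem g w) g.
Proof.
case: g => [|g] pw gin //; have := pw g; rewrite /addable /= !(cnt_rem gin).
lia.
Qed.

(** The row of the largest letter is a corner; removing one such letter leaves a partition, and the
    letter is put at the end. *)
Lemma partc_yamP w : partc w -> exists2 v, yam v & perm_eq v w.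
Proof.
move: {2}(size w) (leqnn (size w)) => m; elim: m w => [|m IH] w.
  by rewrite leqn0 size_eq0 => /eqP-> _; exists [::].
case: w => [|x0 w0] sw pw; first by exists [::].
set w := x0 :: w0 in sw pw *; pose g := foldr maxn 0 w.
have le_g x : x \in w -> x <= g.
  by rewrite /g; elim: (w) => //= y t IHt; rewrite inE => /orP[/eqP->|/IHt]; lia.
have gin : g \in w.
  rewrite /g /w; elim: (w0) (x0) => [|y t IHt] x; first by rewrite /= maxn0 inE.
  rewrite [foldr _ _ _]/= -[foldr maxn 0 t]/(foldr maxn 0 t) inE.
  have := IHt y; rewrite [foldr _ _ (y :: t)]/=; move: (maxn y _) => M My.
  by case: (leqP x M) => h; [rewrite My orbT | rewrite eqxx].
have g0 : cnt g.+1 w = 0.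
  by apply/eqP; rewrite -leqn0 leqNgt cnt_gt0; apply/negP => /le_g; rewrite ltnn.
have gw : cnt g.+1 w < cnt g w by rewrite g0 cnt_gt0.
have [|v yv vw] := IH (rem g w) _ (partc_rem pw gw).
  by rewrite size_rem //; move: sw; case: (size w).
exists (rcons v g); first by rewrite yam_rcons yv (addable_perm _ vw) addable_rem.
apply: (@perm_trans _ (g :: rem g w)); last by rewrite perm_sym perm_to_rem.
by rewrite perm_rcons perm_cons.
Qed.

Lemma corner_yam g w : partc w -> cnt g.+1 w < cnt g w ->
  exists2 v, yam (rcons v g) & perm_eq (rcons v g) w.
Proof.
move=> pw gw; have gin : g \in w by rewrite -cnt_gt0; lia.
have [v yv vw] := partc_yamP (partc_rem pw gw).
exists v; first by rewrite yam_rcons yv (addable_perm _ vw) addable_rem.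
apply: (@perm_trans _ (g :: rem g w)); last by rewrite perm_sym perm_to_rem.
by rewrite perm_rcons perm_cons.
Qed.

(** For addable [c < c'] the row [c' - 1] is a corner strictly above [c'] but not above [c]. Unknown
    rows are always identified in this way, by comparison with corners. *)
Lemma addable_inj v c c' : addable v c -> addable v c' ->
  (forall g, cnt g.+1 v < cnt g v -> (g < c) = (g < c')) -> c = c'.
Proof.
wlog lt : c c' / c <= c' => [hw|] ac ac' h.
  case/orP: (leq_total c c') => le; first exact: hw.
  by apply/esym/hw => // g gv; rewrite h.
case: (eqVneq c c') => // ne; case: c' => [|g] in lt ac' ne h *; first lia.
have gv : cnt g.+1 v < cnt g v by [].
by have := h g gv; lia.
Qed.

Lemma rcons_corner v g : yam (rcons v g) -> cnt g.+1 (rcons v g) < cnt g (rcons v g).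
Proof.
by rewrite yam_rcons => /andP[/yam_partc /(_ g)]; rewrite !cnt_rcons; lia.
Qed.

(** * Connectedness of the lattice words of one content under Knuth moves *)

Definition dact (s : seq nat) (r : seq nat) : seq nat := foldl (fun x j => dd j x) r s.

Lemma dact_cat s t r : dact (s ++ t) r = dact t (dact s r).
Proof. exact: foldl_cat. Qed.

Lemma size_dact s r : size (dact s r) = size r.
Proof. by elim: s r => //= i s IH r; rewrite IH size_dd. Qed.

Lemma dact_rcons s r c : all (fun i => 1 < i < size r) s ->
  dact s (rcons r c) = rcons (dact s r) c.
Proof.
elim: s r => //= i s IH r /andP[ir sr]; rewrite dd_rcons // IH //.
by rewrite size_dd.
Qed.

Lemma all_lt_widen m m' s : m <= m' ->
  all (fun i => 1 < i < m) s -> all (fun i => 1 < i < m') s.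
Proof. by move=> le; apply: sub_all => i; lia. Qed.

Lemma perm_rcons2 (c : nat) u v : perm_eq (rcons u c) (rcons v c) = perm_eq u v.
Proof. by rewrite -!cats1 perm_cat2r. Qed.

(** Addability of the lower row [maxn d e], which is positive, says that the row above it is a
    corner. *)
Lemma between_yam u d e : yam u -> addable u d -> addable u e -> d != e ->
  exists2 t, yam (rcons t (maxn d e).-1) & perm_eq (rcons t (maxn d e).-1) u.
Proof.
move=> yu ad ae ne; apply: corner_yam; first exact: yam_partc.
have : addable u (maxn d e) by case/orP: (leq_total d e) => /[dup] h /maxn_idPr; rewrite ?(maxnC d) => ->.
by rewrite /addable prednK; lia.
Qed.

(* The letter [f] is a witness for the Knuth move between [t f b a] and [t f a b]. *)
Lemma two_corners u a v b : yam (rcons u a) -> yam (rcons v b) ->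
  perm_eq (rcons u a) (rcons v b) -> a != b ->
  exists t, let f := (maxn a b).-1 in
    [/\ yam (t ++ [:: f; b; a]), yam (t ++ [:: f; a; b]) & perm_eq (rcons u a) (t ++ [:: f; b; a])].
Proof.
move=> yu yv uv ne; have ca := rcons_corner yu; have cb := rcons_corner yv.
have cuv := cnt_perm uv; rewrite -!cuv in cb.
set w := rcons u a in yu uv ca cb cuv *.
have pw := yam_partc yu.
have ain : a \in w by rewrite mem_rcons inE eqxx.
have bin : b \in rem a w.
  by rewrite -cnt_gt0; have := cnt_rem ain b; rewrite (negPf ne); lia.
have pa := partc_rem pw ca.
have cb' : cnt b.+1 (rem a w) < cnt b (rem a w).
  by move: cb; rewrite !(cnt_rem ain) (negPf ne); lia.
have pb := partc_rem pa cb'.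
have [x yx xw] := partc_yamP pb.
have cx j : cnt j w = cnt j x + (b == j) + (a == j) by rewrite (cnt_rem ain) (cnt_rem bin) (cnt_perm xw).
have aa : addable x a.
  rewrite /addable; have := pw a.-1; case: (a) ca ne cx => //= a' ca ne cx.
  by move: ca cb; rewrite !cx; move: ne; clear; case: (eqVneq b a') => [->|?]; lia.
have ab : addable x b.
  rewrite /addable; have := pw b.-1; case: (b) cb ne cx => //= b' cb ne cx.
  by move: ca cb; rewrite !cx; move: ne; clear; case: (eqVneq a b') => [->|?]; lia.
have [t yt tx] := between_yam yx aa ab ne.
exists t; set f := (maxn a b).-1 in yt tx *; move=> /=.
have e3 p q : t ++ [:: f; p; q] = rcons (rcons (rcons t f) p) q by rewrite -!cats1 -!catA.
have xab p q : addable x p -> addable x q -> p != q -> yam (rcons (rcons (rcons t f) p) q).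
  move=> ap aq pq; rewrite !(yam_rcons (rcons _ _)) yt (addable_perm _ tx) ap /=.
  by apply: addable_weaken => //; rewrite (addable_perm _ tx).
rewrite !e3; split; [by apply: xab; rewrite // eq_sym | exact: xab |].
by apply: perm_cnt => j; rewrite !(cnt_rcons _ (rcons _ _)) cx (cnt_perm tx).
Qed.

Lemma dact_catr s u t : all (fun i => 1 < i < size u) s -> dact s (u ++ t) = dact s u ++ t.
Proof.
move=> su; elim/last_ind: t => [|t x IH]; rewrite ?cats0 // -!rcons_cat dact_rcons ?IH //.
by apply: all_lt_widen su; rewrite size_cat leq_addr.
Qed.

Lemma dd_shift v i r : 1 < i -> dd (size v + i) (v ++ r) = v ++ dd i r.
Proof.
move=> i1; rewrite /dd; have -> : size v + i - 2 = size v + (i - 2) by lia.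
by rewrite take_cat drop_cat !ltnNge !leq_addr /= addKn catA.
Qed.

(** Induction on the length. Words with equal last letters are joined inside their prefixes;
    otherwise each is first brought to one of the two words of [two_corners], which differ by a
    single move. *)
Lemma yam_connected u v : yam u -> yam v -> perm_eq u v ->
  exists2 s, all (fun i => 1 < i < size u) s & dact s u = v.
Proof.
move: {2}(size u) (erefl (size u)) => m; elim: m u v => [|m IH] u v.
  by move=> /size0nil-> _ _ /perm_size /esym/size0nil->; exists [::].
have base c u1 v1 : size u1 = m -> yam (rcons u1 c) -> yam (rcons v1 c) ->
    perm_eq (rcons u1 c) (rcons v1 c) ->
    exists2 s, all (fun i => 1 < i < m.+1) s & dact s (rcons u1 c) = rcons v1 c.
  move=> su1; rewrite !yam_rcons perm_rcons2 => /andP[y1 _] /andP[y2 _] p.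
  have [s s1 s2] := IH _ _ su1 y1 y2 p; rewrite su1 in s1; exists s.
    exact: all_lt_widen s1.
  by rewrite dact_rcons ?su1 // s2.
case/lastP: u => [|u a] //; case/lastP: v => [|v b]; first by move=> _ _ _ /perm_size; rewrite size_rcons.
move=> su yu yv uv; rewrite su; move: su; rewrite size_rcons => -[su].
case: (eqVneq a b) => [e|ne]; first by subst b; apply: base.
have [t] := two_corners yu yv uv ne; set f := (maxn a b).-1 => /= -[yba yab wx].
have sz : (size t).+2 = m by have := perm_size wx; rewrite size_rcons su size_cat /= addn3 => -[].
have e3 p q : t ++ [:: f; p; q] = rcons (rcons (rcons t f) p) q by rewrite -!cats1 -!catA.
have szr (p : nat) : size (rcons (rcons t f) p) = m by rewrite !size_rcons.
rewrite e3 in yba wx; rewrite e3 in yab.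
have [s1 s1m s1e] := base a u _ su yu yba wx.
have [s2 s2m s2e] : exists2 s, all (fun i => 1 < i < m.+1) s & dact s (rcons (rcons (rcons t f) a) b) = rcons v b.
  apply: base => //; apply: perm_trans uv; rewrite perm_sym; apply: (perm_trans wx).
  by rewrite -!e3 perm_cat2l; apply: (perm_swap [:: f]).
(* The words have [m + 1] letters, so [dd m] is the move on the last three. *)
exists (s1 ++ m :: s2).
  by rewrite all_cat s1m /= s2m -sz !ltnS leqnn.
rewrite dact_cat s1e /= -s2e; congr dact.
rewrite -!e3 dd_cat; last by rewrite -sz subn2.
have -> : (f < b) == (b < a) = false by rewrite /f; move: ne; clear; lia.
by have -> : (f < a) == (f < b) = false by rewrite /f; move: ne; clear; lia.
Qed.

Lemma ddK i r : dd i (dd i r) = r.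
Proof.
case: (ltnP (i - 2 + 2) (size r)) => sr; last first.
  have e : dd i r = r.
    rewrite -[RHS](cat_take_drop (i - 2)) /dd; congr (_ ++ _).
    have : size (drop (i - 2) r) <= 2 by rewrite size_drop; lia.
    by case: (drop _ _) => [|x [|y [|z t]]].
  by rewrite !e.
have [u [x [y [z [t [-> su]]]]]] : exists u x y z t, r = u ++ [:: x, y, z & t] /\ size u = i - 2.
  exists (take (i - 2) r); have := cat_take_drop (i - 2) r.
  have : size (drop (i - 2) r) = size r - (i - 2) by rewrite size_drop.
  case: (drop _ _) => [|x [|y [|z t]]] /= sd e; try lia.
  exists x, y, z, t; split=> //; rewrite size_takel //; lia.
rewrite dd_cat //; case: ifP => n1; first by rewrite dd_cat // n1.
case: ifP => n2.
  rewrite dd_cat //.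
  have -> : (y < x) == (x < z) = false by move: n1 n2; clear; lia.
  by have -> : (y < z) == (y < x) by move: n1 n2; clear; lia.
rewrite dd_cat //.
have -> : (x < z) == (z < y) = false by move: n1 n2; clear; lia.
by have -> : (x < y) == (x < z) = false by move: n1 n2; clear; lia.
Qed.

(** Version of [corner_yam] for iteration: it records the counts after removal, so that corners can
    be taken off in turn and put back in reverse order. *)
Lemma corner_step w g : partc w -> cnt g.+1 w < cnt g w ->
  exists w', [/\ partc w', forall j, cnt j w = cnt j w' + (g == j) &
    forall v, yam v -> perm_eq v w' -> yam (rcons v g) /\ perm_eq (rcons v g) w].
Proof.
move=> pw gw; have gin : g \in w by rewrite -cnt_gt0; lia.
exists (rem g w); split; [exact: partc_rem | exact: cnt_rem |] => v yv vw; split.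
  by rewrite yam_rcons yv (addable_perm _ vw) addable_rem.
apply: (@perm_trans _ (g :: rem g w)); last by rewrite perm_sym perm_to_rem.
by rewrite perm_rcons perm_cons.
Qed.

Lemma eqSn_false j : (j.+1 == j) = false. Proof. by elim: j. Qed.

Lemma neq_false (i j : nat) : i < j -> (i == j) = false. Proof. by move/ltn_eqF. Qed.

(* Removing three corners [a < b < c] frees the corners in rows [b - 1] and [c - 1], and then [h]. *)
Lemma six_corners w a b c : yam w -> a < b -> b < c ->
  cnt a.+1 w < cnt a w -> cnt b.+1 w < cnt b w -> cnt c.+1 w < cnt c w ->
  exists v h f g, [/\ a <= g <= h, h < f < c, g < b <= f,
    yam (v ++ [:: h; f; c; g; b; a]) & perm_eq w (v ++ [:: h; f; c; g; b; a])].
Proof.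
case: b => // g; case: c => // f yw; rewrite !ltnS => ag gf ca cb cc.
have pw := yam_partc yw.
have [w1 [p1 c1 y1]] := corner_step pw ca.
have cb1 : cnt g.+2 w1 < cnt g.+1 w1.
  by move: cb; rewrite !c1 !neq_false ?addn0 // ltnS ?(leq_trans ag).
have [w2 [p2 c2 y2]] := corner_step p1 cb1.
have cg2 : cnt g.+1 w2 < cnt g w2.
  have := pw g; rewrite !c1 !c2 (neq_false (_ : a < g.+1)) // eqSn_false eqxx.
  case: (eqVneq a g) => [eag|_]; last by clear; lia.
  by move: ca; rewrite eag !c1 !c2 (neq_false (_ : a < g.+1)) // eag eqSn_false !eqxx; clear; lia.
have [w3 [p3 c3 y3]] := corner_step p2 cg2.
have cc3 : cnt f.+2 w3 < cnt f.+1 w3.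
  move: cc; rewrite !c1 !c2 !c3 !neq_false ?addn0 //; move: ag gf; clear; lia.
have [w4 [p4 c4 y4]] := corner_step p3 cc3.
have cf4 : cnt f.+1 w4 < cnt f w4.
  have := pw f; rewrite !c1 !c2 !c3 !c4 eqxx eqSn_false.
  have -> : (a == f.+1) = false by apply: neq_false; move: ag gf; clear; lia.
  have -> : (a == f) = false by apply: neq_false; move: ag gf; clear; lia.
  have -> : (g == f.+1) = false by apply: neq_false; move: ag gf; clear; lia.
  have -> : (g == f) = false by apply: neq_false; move: ag gf; clear; lia.
  have -> : (g.+1 == f.+1) = false by apply: neq_false; move: ag gf; clear; lia.
  case: (eqVneq g.+1 f) => [egf|_]; last by clear; lia.
  move: cb cc; rewrite egf; rewrite !c1 !c2 !c3 !c4 eqxx eqSn_false.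
  have -> : (a == f.+1) = false by apply: neq_false; move: ag gf; clear; lia.
  have -> : (a == f) = false by apply: neq_false; move: ag gf; clear; lia.
  have -> : (g == f.+1) = false by apply: neq_false; move: ag gf; clear; lia.
  have -> : (g == f) = false by apply: neq_false; move: ag gf; clear; lia.
  have -> : (g.+1 == f.+1) = false by apply: neq_false; move: ag gf; clear; lia.
  by rewrite egf eqxx; clear; lia.
have [w5 [p5 c5 y5]] := corner_step p4 cf4.
(* In both cases [h = f - 1], the row above [f]; the split keeps track of the cells that this row
   has already lost. *)
have [h [hP [hf ch]]] : exists h, a <= g <= h /\ h < f < f.+1 /\ cnt h.+1 w5 < cnt h w5.
  case: (eqVneq g.+1 f) => [egf|ngf].
    subst f; exists g; rewrite ag leqnn !ltnSn; split=> //; split=> //.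
    have := pw g; have := ca; rewrite !c1 !c2 !c3 !c4 !c5.
    by case: (eqVneq a g) => [->|ne]; move: ag; clear; lia.
  have [f1 ef] : exists f1, f = f1.+1 by exists f.-1; move: gf ngf; clear; lia.
  subst f; exists f1.
  have gf' : g < f1 by move: gf ngf; clear; lia.
  rewrite ag !ltnSn (ltnW gf'); split=> //; split=> //.
  have := pw f1; have := cb; rewrite !c1 !c2 !c3 !c4 !c5.
  by case: (eqVneq g.+1 f1) => [<-|ne]; move: ag gf'; clear; lia.
have [w6 [p6 _ y6]] := corner_step p5 ch.
have [v yv vw] := partc_yamP p6.
have [yh ph] := y6 v yv vw; have [yf pf] := y5 _ yh ph; have [yc pc] := y4 _ yf pf.
have [yg pg] := y3 _ yc pc; have [yb pb] := y2 _ yg pg; have [ya pa] := y1 _ yb pb.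
exists v, h, f, g; split=> //; first by rewrite ltnSn.
  by move: ya; rewrite -!cats1 -!catA.
by rewrite perm_sym; move: pa; rewrite -!cats1 -!catA.
Qed.

(** * Schur coefficients as sums over lattice words *)

Definition wdes (v : seq nat) : pred nat := fun j => nth 0 v j.-1 < nth 0 v j.

Lemma sorted_count r j x : sorted leq r -> j < size r ->
  (nth 0 r j < x) = (j < count (fun y => y < x) r).
Proof.
elim: r j => [|y r IH] j //= pyr jr.
have yr z : z \in r -> y <= z by move=> zr; apply: (allP (order_path_min leq_trans pyr)).
case: (ltnP y x) => yx.
  case: j jr => [|j] /= jr; first by rewrite yx.
  by rewrite IH ?(path_sorted pyr).
have -> : count (fun z => z < x) r = 0.
  by apply/eqP; rewrite -leqn0 leqNgt -has_count; apply/hasPn => z /yr; lia.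
rewrite ltn0; case: j jr => [|j] /= jr; first lia.
by apply/negbTE; rewrite -leqNgt (leq_trans yx) // yr ?mem_nth.
Qed.

(** Counting entries below a threshold replaces positions in a row, so that column strictness can be
    compared with prefix counts of a word. *)
Lemma col_strictP r1 r2 : sorted leq r1 -> sorted leq r2 ->
  reflect (forall x, count (fun y => y < x.+1) r2 <= count (fun y => y < x) r1) (col_strict r1 r2).
Proof.
move=> s1 s2; apply: (iffP andP) => [[le /allP h] x|h].
  have [->//|] := posnP (count (fun y => y < x.+1) r2); set k := count _ r2 => k0.
  have kr2 : k <= size r2 by apply: count_size.
  have jk : k.-1 < size r2 by lia.
  have := sorted_count x.+1 s2 jk; rewrite -/k.
  have /h lt : k.-1 \in iota 0 (size r2) by rewrite mem_iota; lia.
  have := sorted_count x s1 (leq_trans jk le); lia.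
have le : size r2 <= size r1.
  have := h (foldr maxn 0 r2).
  have /eqP -> : count (fun y => y < (foldr maxn 0 r2).+1) r2 == size r2.
    rewrite -all_count; elim: (r2) => //= y t /allP IH; apply/andP; split; first lia.
    by apply/allP => z /IH; lia.
  by move=> H; apply: leq_trans H (count_size _ _).
split=> //; apply/allP => j; rewrite mem_iota add0n => /andP[_ jr].
rewrite (sorted_count _ s1 (leq_trans jr le)); apply: leq_trans (h (nth 0 r2 j)).
by have := sorted_count (nth 0 r2 j).+1 s2 jr; rewrite ltnSn => <-.
Qed.

Lemma yamP v : reflect (forall k j, cnt j.+1 (take k v) <= cnt j (take k v)) (yam v).
Proof.
apply: (iffP idP) => [yv k j|].
  by apply: yam_cnt; apply: (@yam_catl _ (drop k v)); rewrite cat_take_drop.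
elim/last_ind: v => [|v x IH] // h; rewrite yam_rcons; apply/andP; split.
  apply: IH => k j; case: (leqP k (size v)) => kv.
    by have := h k j; rewrite -cats1 takel_cat.
  by have := h (size v) j; rewrite -cats1 take_size_cat // take_oversize // ltnW.
case: x h => // x h; have := h (size v).+1 x.
rewrite take_oversize ?size_rcons // !cnt_rcons eqxx.
have -> : (x.+1 == x) = false by lia.
by rewrite /= addn0 addn1.
Qed.

(* Standardization order on (entry, row): equal entries are read from the bottom row up. *)
Definition stdle (p q : nat * nat) : bool := (p.1 < q.1) || ((p.1 == q.1) && (q.2 <= p.2)).

Lemma stdle_total : total stdle. Proof. move=> [a b] [c d]; rewrite /stdle /=; lia. Qed.
Lemma stdle_trans : transitive stdle.
Proof. move=> [a b] [c d] [e f]; rewrite /stdle /=; lia. Qed.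
Lemma stdle_anti : antisymmetric stdle.
Proof. by move=> [a b] [c d]; rewrite /stdle /= => h; congr (_, _); lia. Qed.

(** A tableau is kept as the list of its cells (entry, row); sorted by [stdle], the entries form the
    monomial and the rows form a lattice word. *)
Definition trow (i : nat) (s : seq (nat * nat)) : seq nat := [seq p.1 | p <- s & p.2 == i].
Definition trows (l : nat) (s : seq (nat * nat)) : seq (seq nat) := [seq trow i s | i <- iota 0 l].

Lemma count_trow (a : pred nat) i s : count a (trow i s) = count (fun p => (p.2 == i) && a p.1) s.
Proof. by rewrite /trow count_map count_filter; apply: eq_count => p /=; rewrite andbC. Qed.

Lemma sorted_trow i s : sorted stdle s -> sorted leq (trow i s).
Proof.
move=> ss; have := sorted_filter stdle_trans (fun p => p.2 == i) ss; rewrite -/(trow i s) /trow.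
rewrite sorted_map; have := filter_all (fun p : nat * nat => p.2 == i) s.
move: (filter _ _) => t; case: t => //= p t /andP[_]; elim: t p => //= q t IH p /andP[_ h] /andP[pq pt].
by rewrite (IH q) // andbT; move: pq; rewrite /stdle /=; lia.
Qed.

Lemma cnt_unzip2 j (s : seq (nat * nat)) : cnt j (unzip2 s) = count (fun p => p.2 == j) s.
Proof. by rewrite /cnt /unzip2 count_map; apply: eq_count. Qed.

Lemma sorted_take_count (T : Type) (e : rel T) (Q : pred T) s : transitive e -> sorted e s ->
  (forall p q, e p q -> Q q -> Q p) -> filter Q s = take (count Q s) s.
Proof.
move=> te + dQ; elim: s => //= p s IH ps.
case: ifP => Qp /=; first by rewrite IH ?(path_sorted ps).
have ps' := order_path_min te ps.
have h : ~~ has Q s.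
  apply/negP; elim: s ps' {IH ps} => //= q s IH /andP[pq ps] /orP[/(dQ _ _ pq)|/(IH ps)//].
  by rewrite Qp.
have c0 : count Q s = 0 by apply/eqP; rewrite -leqn0 leqNgt -has_count.
by rewrite c0 take0; apply/nilP; rewrite /nilp size_filter c0.
Qed.

(** Both conditions bound row [j + 1] by row [j], one below each threshold on the entries, the other
    in each initial segment. Sorting by [stdle] turns the first kind of bound into the second and
    back. *)
Lemma yam_trows s l : sorted stdle s -> (forall j, l <= j -> cnt j (unzip2 s) = 0) ->
  is_ssyt (trows l s) = yam (unzip2 s).
Proof.
move=> ss hl; rewrite /is_ssyt.
have -> /= : all (sorted leq) (trows l s).
  by apply/allP => r /mapP[i _ ->]; apply: sorted_trow.
have sz : size (trows l s) = l by rewrite size_map size_iota.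
have nthr i : i < l -> nth [::] (trows l s) i = trow i s.
  by move=> il; rewrite (nth_map 0) ?size_iota // nth_iota.
apply/idP/idP.
  move/(sortedP [::]); rewrite sz => h.
  have {}h i x : i.+1 < l -> count (fun p => (p.2 == i.+1) && (p.1 < x.+1)) s <= count (fun p => (p.2 == i) && (p.1 < x)) s.
    move=> il; have := h i il; rewrite !nthr //; last lia.
    by move/(col_strictP (sorted_trow _ ss) (sorted_trow _ ss))/(_ x); rewrite !count_trow.
  apply/yamP => k j; case: (leqP l j.+1) => lj.
    apply: leq_trans (leq0n _); rewrite -(hl _ lj) -{2}(cat_take_drop k (unzip2 s)) cnt_cat.
    exact: leq_addr.
  elim: k => [|k IH]; first by rewrite take0.
  case: (leqP (size s) k) => ks.
    by move: IH; rewrite !take_oversize ?size_map // ltnW.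
  rewrite !(take_nth 0) ?size_map // !cnt_rcons.
  case: (eqVneq (nth 0 (unzip2 s) k) j.+1) => [ek|nk]; last by rewrite addn0 (leq_trans IH) ?leq_addr.
  set p := nth (0, 0) s k; have p2 : p.2 = j.+1 by rewrite -ek (nth_map (0,0)).
  rewrite ek; have ->: (j.+1 == j) = false by lia.
  rewrite addn0 addn1 -!map_take !cnt_unzip2.
  (* With threshold [p.1], the cell [p] itself counts in row [j + 1], while the cells of row [j]
     with a smaller entry all precede [p]. *)
  have := h j p.1 lj.
  rewrite -{1 2}(cat_take_drop k s) (drop_nth (0,0) ks) -/p !count_cat /= p2 eqxx ltnSn /=.
  have ->: (j.+1 == j) = false by lia.
  have sk := ss; rewrite -(cat_take_drop k s) (drop_nth (0,0) ks) -/p in sk.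
  move: sk; rewrite (sorted_pairwise stdle_trans) pairwise_cat /= => /and3P[/allrelP tp _ /andP[/allP dp _]].
  have tp1 q : q \in take k s -> q.1 <= p.1.
    by move=> qs; case/orP: (tp q p qs (mem_head _ _)) => [/ltnW|/andP[/eqP->]].
  have -> : count (fun q => (q.2 == j) && (q.1 < p.1)) (drop k.+1 s) = 0.
    apply/eqP; rewrite -leqn0 leqNgt -has_count; apply/hasPn => q /dp.
    case/orP => [lt|/andP[/eqP e _]]; first by rewrite negb_and -leqNgt (ltnW lt) orbT.
    by rewrite e ltnn andbF.
  have -> : count (fun q => (q.2 == j.+1) && (q.1 < p.1.+1)) (take k s) = count (fun q => q.2 == j.+1) (take k s).
    by apply: eq_in_count => q /tp1; rewrite ltnS => ->; rewrite andbT.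
  have : count (fun q => (q.2 == j) && (q.1 < p.1)) (take k s) <= count (fun q => q.2 == j) (take k s).
    by apply: sub_count => q /andP[].
  move=> le1; rewrite !addn0 => le2; apply: leq_trans le1; apply: leq_trans le2.
  by rewrite addnA addn1 leq_addr.
move=> yv; have h := fun k j => yamP _ yv k j; apply/(sortedP [::]); rewrite sz => i il; rewrite !nthr //; last lia.
apply/(col_strictP (sorted_trow _ ss) (sorted_trow _ ss)) => x; rewrite !count_trow.
(* This initial segment contains the cells of row [i + 1] with entry at most [x], but those of row
   [i] only with entry below [x]. *)
pose Q (p : nat * nat) := (p.1 < x) || ((p.1 == x) && (i < p.2)).
have /(congr1 (fun t => unzip2 t)) : filter Q s = take (count Q s) s.
  apply: (sorted_take_count stdle_trans ss) => -[a b] [c d]; rewrite /stdle /Q /=; lia.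
rewrite /unzip2 map_take => e; have := h (count Q s) i; rewrite -e !cnt_unzip2 !count_filter.
have -> : count (predI (fun p => p.2 == i.+1) Q) s = count (fun p => (p.2 == i.+1) && (p.1 < x.+1)) s.
  by apply: eq_count => -[a b] /=; rewrite /Q /=; lia.
have -> // : count (predI (fun p => p.2 == i) Q) s = count (fun p => (p.2 == i) && (p.1 < x)) s.
by apply: eq_count => -[a b] /=; rewrite /Q /=; lia.
Qed.

(** Where [v] ascends, [stdle] forbids equal entries; elsewhere it allows them. *)
Lemma Qcoeff_sorted w v : sorted leq w -> size v = size w ->
  Qcoeff (wdes v) w = sorted stdle (zip w v).
Proof.
move=> sw sv; have zs : size (zip w v) = size w by rewrite size_zip sv minnn.
have nz k : k < size w -> nth (0, 0) (zip w v) k = (nth 0 w k, nth 0 v k) by move=> _; apply: nth_zip.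
apply/allP/(sortedP (0, 0)) => h k.
  rewrite zs => kw; have := h k.+1; rewrite mem_iota /wdes /= !nz //; last lia.
  have /(sortedP 0)/(_ k kw) := sw.
  by rewrite /stdle /=; lia.
rewrite mem_iota /wdes => kw; have := h k.-1; rewrite zs prednK ?nz //; try lia.
by rewrite /stdle /=; lia.
Qed.

Lemma flatten_pick (T : Type) (r : nat -> seq T) l i :
  flatten [seq if k == i then r k else [::] | k <- iota 0 l] = if i < l then r i else [::].
Proof.
elim: l => // l IH; rewrite -addn1 iotaD map_cat flatten_cat IH /= cats0 add0n.
by case: (ltngtP i l) => [lt|gt|->]; rewrite ?cats0 ?addn1 ?ltnS ?leqnn ?ltnn //=; case: ifP => //; lia.
Qed.

Lemma trow_flatten i ss : trow i (flatten ss) = flatten (map (trow i) ss).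
Proof. by rewrite /trow filter_flatten map_flatten -!map_comp. Qed.

Definition cells (t : seq (seq nat)) : seq (nat * nat) :=
  flatten [seq [seq (x, i) | x <- nth [::] t i] | i <- iota 0 (size t)].

Lemma trow_cells t i : trow i (cells t) = nth [::] t i.
Proof.
rewrite /cells trow_flatten -map_comp.
have -> : [seq (trow i \o (fun i0 => [seq (x, i0) | x <- nth [::] t i0])) i1 | i1 <- iota 0 (size t)]
   = [seq if k == i then nth [::] t k else [::] | k <- iota 0 (size t)].
  apply: eq_map => k /=; rewrite /trow filter_map -map_comp map_id_in //=.
  by case: eqP => [->|/eqP/negPf ne]; elim: (nth _ _ _) => //= y r ->; rewrite /= ?eqxx ?ne.
by rewrite flatten_pick; case: ltnP => // le; rewrite nth_default.
Qed.

Lemma unzip1_cells t : unzip1 (cells t) = flatten t.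
Proof.
rewrite /cells /unzip1 map_flatten -map_comp; congr flatten.
rewrite -[RHS](mkseq_nth [::]); apply: eq_map => i /=.
by rewrite -map_comp map_id.
Qed.

Lemma count_trows (s : seq (nat * nat)) t : (forall i, trow i s = trow i t) -> perm_eq s t.
Proof.
move=> h; apply/allP => -[x i] _; apply/eqP; have := congr1 (count_mem x) (h i).
rewrite !count_trow; have ex u : count (fun p : nat * nat => (p.2 == i) && pred1 x p.1) u = count_mem (x, i) u.
  by apply: eq_count => -[y j] /=; rewrite xpair_eqE andbC.
by rewrite !ex.
Qed.

Lemma trow_nil i s : cnt i (unzip2 s) = 0 -> trow i s = [::].
Proof.
by rewrite cnt_unzip2 => h; apply/nilP; rewrite /nilp /trow size_map size_filter h.
Qed.

Lemma nth_trows l s i : i < l -> nth [::] (trows l s) i = trow i s.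
Proof. by move=> il; rewrite (nth_map 0) ?size_iota // nth_iota. Qed.

Lemma trows_inj l s t : (forall j, l <= j -> cnt j (unzip2 s) = 0) ->
  (forall j, l <= j -> cnt j (unzip2 t) = 0) -> trows l s = trows l t -> perm_eq s t.
Proof.
move=> hs ht e; apply: count_trows => i; case: (ltnP i l) => il.
  by rewrite -(nth_trows s il) e nth_trows.
by rewrite !trow_nil ?hs ?ht.
Qed.

Lemma flatten_trows l s : (forall j, l <= j -> cnt j (unzip2 s) = 0) ->
  perm_eq (flatten (trows l s)) (unzip1 s).
Proof.
move=> hs; rewrite -unzip1_cells; apply: perm_map; apply: count_trows => i.
rewrite trow_cells; case: (ltnP i l) => il; first exact: nth_trows.
by rewrite nth_default ?trow_nil ?hs // size_map size_iota.
Qed.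

(** Standardization: a lattice word [v] compatible with [w] gives the tableau with cells [zip w v];
    conversely, sorting the cells of a tableau by [stdle] and reading off their rows gives [v]. *)
Lemma schur_coeffE la w v0 : sorted leq w -> yam v0 -> size v0 = size w ->
  sumn la = size w -> (forall j, cnt j v0 = nth 0 la j) ->
  schur_coeff la w = count (fun v => perm_eq v0 v && Qcoeff (wdes v) w) (allyam (size w)).
Proof.
move=> sw yv0 sv0 sla cla; set l := size la; pose F v := flatten (trows l (zip w v)).
rewrite /schur_coeff -[LHS]size_filter -[RHS]size_filter -[in RHS](size_map F).
have u2 (v : seq nat) : size v = size w -> unzip2 (zip w v) = v by move=> e; rewrite unzip2_zip ?e.
have L2P (v : seq nat) : v \in [seq v <- allyam (size w) | perm_eq v0 v && Qcoeff (wdes v) w] ->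
  [/\ size v = size w, yam v, sorted stdle (zip w v), (forall j, l <= j -> cnt j v = 0) & trows l (zip w v) = reshape la (F v)].
  rewrite mem_filter mem_allyam => /andP[/andP[pv Qv] /andP[yv /eqP sv]].
  have cv j : cnt j v = nth 0 la j by rewrite -(cnt_perm pv).
  split=> //; first by rewrite -Qcoeff_sorted.
    by move=> j jl; rewrite cv nth_default.
  rewrite /F -[X in reshape X](_ : shape (trows l (zip w v)) = la) ?flattenK //.
  rewrite /shape /trows -map_comp -[RHS](mkseq_nth 0); apply: eq_map => i /=.
  by rewrite -cv -{2}(u2 v sv) cnt_unzip2 /trow size_map size_filter.
apply/perm_size/uniq_perm; first by rewrite filter_uniq ?permutations_uniq.
  rewrite map_inj_in_uniq ?filter_uniq ?uniq_allyam // => v v' /L2P[sv _ ss hv rv] /L2P[sv' _ ss' hv' rv'] e.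
  have : zip w v = zip w v'.
    apply: (sorted_eq stdle_trans stdle_anti) => //; apply: (@trows_inj l); rewrite ?u2 //.
    by rewrite rv rv' e.
  by move/(congr1 unzip2); rewrite !u2.
move=> p; rewrite mem_filter mem_permutations; apply/andP/mapP => [[tp pw]|[v vL ->]]; last first.
  have [sv yv ss hv rv] := L2P v vL; split.
    by rewrite -rv yam_trows ?u2.
  have := @flatten_trows l (zip w v); rewrite unzip1_zip ?sv //; apply.
  by rewrite u2.
set t := reshape la p in tp; have sp : size p = sumn la by rewrite sla (perm_size pw).
have ft : flatten t = p by apply: reshapeKr; rewrite sp.
have sht : shape t = la by apply: reshapeKl; rewrite sp.
have st : size t = l by rewrite /l -sht size_map.
pose s := sort stdle (cells t).
have ss : sorted stdle s by apply: sort_sorted stdle_total _.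
have psc : perm_eq s (cells t) by rewrite /s perm_sort.
have rowt i : sorted leq (nth [::] t i).
  case: (ltnP i (size t)) => it; last by rewrite nth_default.
  by case/andP: tp => /allP h _; apply/h/mem_nth.
have rs i : trow i s = nth [::] t i.
  apply: (sorted_eq leq_trans anti_leq) => //; first exact: sorted_trow.
  rewrite -trow_cells; apply: perm_map; exact: perm_filter.
have us : unzip1 s = w.
  apply: (sorted_eq leq_trans anti_leq) => //.
    rewrite sorted_map; apply: sub_sorted ss => -[a b] [c d]; rewrite /stdle /=; lia.
  by apply: perm_trans pw; rewrite -ft -unzip1_cells perm_map.
have zs : zip w (unzip2 s) = s by rewrite -us zip_unzip.
have suv : size (unzip2 s) = size w by rewrite -us !size_map.
have cs j : cnt j (unzip2 s) = nth 0 la j.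
  rewrite cnt_unzip2; have := congr1 size (rs j); rewrite /trow size_map size_filter => ->.
  case: (ltnP j l) => jl; last by rewrite !nth_default ?st.
  by rewrite -sht (nth_map [::]) ?st.
have ts : trows l s = t.
  apply: (@eq_from_nth _ [::]); rewrite size_map size_iota ?st // => i il.
  by rewrite nth_trows.
exists (unzip2 s); last by rewrite /F zs ts ft.
rewrite mem_filter mem_allyam suv eqxx andbT Qcoeff_sorted // zs ss andbT.
rewrite -(yam_trows (l := l)) // ?ts ?tp ?andbT; last by move=> j jl; rewrite cs nth_default.
by apply: perm_cnt => j; rewrite cs.
Qed.

Lemma partition_yam m la : is_partition m la ->
  exists v0, [/\ yam v0, size v0 = m & forall j, cnt j v0 = nth 0 la j].
Proof.
move=> /andP[sla /eqP ela].
pose w0 := flatten [seq nseq (nth 0 la i) i | i <- iota 0 (size la)].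
have c0 j : cnt j w0 = nth 0 la j.
  rewrite /cnt -size_filter filter_flatten -map_comp.
  rewrite (eq_map (g := fun k => if k == j then nseq (nth 0 la k) k else [::])).
    rewrite flatten_pick; case: ltnP => h; first by rewrite size_nseq.
    by rewrite nth_default.
  by move=> k /=; rewrite filter_nseq /=; case: eqP => _; rewrite ?mul1n ?mul0n.
have p0 : partc w0.
  move=> j; rewrite !c0; case: (ltnP j.+1 (size la)) => h; last by rewrite nth_default.
  by move/(sortedP 0): sla; apply.
have [v yv vw] := partc_yamP p0; exists v; split=> // [|j]; last by rewrite (cnt_perm vw).
rewrite (perm_size vw) size_flatten /shape -map_comp -ela -{3}(mkseq_nth 0 la).
by congr sumn; apply: eq_map => i /=; rewrite size_nseq.
Qed.

(** * Linear independence of the fundamental quasisymmetric functions *)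

Definition bleq (b c : bitseq) : bool := all (fun p => p.1 ==> p.2) (zip b c).

Lemma bleq_refl b : bleq b b.
Proof. by elim: b => //= x b; rewrite /bleq /= implybb. Qed.

Lemma bleq_count b c : size b = size c -> bleq b c -> count id b <= count id c ?= iff (b == c).
Proof.
elim: b c => [|x b IH] [|y c] //= [e]; rewrite /bleq /= => /andP[xy /(IH c e) h].
rewrite eqseq_cons; have xy' : x <= y ?= iff (x == y) by move: x y xy => [] [].
exact: leqif_add.
Qed.

(** For a set [b] of least size in either list, the listed sets contained in [b] are the copies of
    [b]. Its multiplicities therefore agree, and one copy is removed from both lists. *)
Lemma perm_bleq k (L1 L2 : seq bitseq) : all (fun b => size b == k) (L1 ++ L2) ->
  (forall b, size b = k -> count (bleq^~ b) L1 = count (bleq^~ b) L2) -> perm_eq L1 L2.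
Proof.
move: {2}(size L1) (leqnn (size L1)) => N; elim: N L1 L2 => [|N IH] L1 L2.
  rewrite leqn0 size_eq0 => /eqP-> /= /allP sL h; case: L2 sL h => // b L2 sL h.
  by have := h b (eqP (sL b (mem_head _ _))); rewrite /= bleq_refl.
move=> sN sL h.
case: (L1 ++ L2 =P [::]) => [|/eqP]; first by case: (L1) => //= ->.
rewrite -size_eq0 => sz.
have [b bL bmin] : exists2 b, b \in L1 ++ L2 & forall c, c \in L1 ++ L2 -> count id b <= count id c.
  elim: (L1 ++ L2) sz => // b [|b' L] IHL _.
    by exists b; rewrite ?mem_head // => c; rewrite inE => /eqP->.
  have [//|c cL cm] := IHL; case: (leqP (count id b) (count id c)) => le.
    exists b; rewrite ?mem_head // => d; rewrite inE => /orP[/eqP->//|/cm]; exact: leq_trans.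
  exists c; first by rewrite inE cL orbT.
  by move=> d; rewrite inE => /orP[/eqP->|/cm//]; apply: ltnW.
have sb := eqP (allP sL b bL).
have cm (L : seq bitseq) : {subset L <= L1 ++ L2} -> count (bleq^~ b) L = count_mem b L.
  move=> sub; apply: eq_in_count => c /sub cL /=.
  have sc : size c = size b by rewrite sb (eqP (allP sL c cL)).
  apply/idP/eqP => [/(bleq_count sc) h'|->]; last exact: bleq_refl.
  by apply/eqP; rewrite -(h'.2) eqn_leq h'.1 bmin.
have e : count_mem b L1 = count_mem b L2.
  by rewrite -!cm ?h // => c cL; rewrite mem_cat cL ?orbT.
have b12 : b \in L1 /\ b \in L2.
  move: bL; rewrite mem_cat -!has_pred1 !has_count e orbb; by [].
case: b12 => b1 b2.
have p1 := perm_to_rem b1; have p2 := perm_to_rem b2.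
rewrite (perm_trans p1) // perm_sym (perm_trans p2) // perm_cons perm_sym; apply: IH.
- by rewrite size_rem //; case: (size L1) sN.
- apply/allP => c; rewrite mem_cat => /orP[] /mem_rem cL; apply: (allP sL); by rewrite mem_cat cL ?orbT.
- move=> c sc; have := h c sc; rewrite (permP p1) (permP p2) /=; lia.
Qed.

Definition desb (m : nat) (D : pred nat) : bitseq := [seq D j | j <- iota 1 m.-1].

Lemma size_desb m D : size (desb m D) = m.-1.
Proof. by rewrite size_map size_iota. Qed.

Lemma Qcoeff_bleq D w : Qcoeff D w = bleq (desb (size w) D) (desb (size w) (wdes w)).
Proof. by rewrite /Qcoeff /bleq /desb; elim: (iota _ _) => //= j l ->. Qed.

(** The partial counts of [b] increase exactly at the positions of [b]. Such monomials separate the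
    functions [Q_D]. *)
Lemma strict_word b : exists w, monomial (size b).+1 w /\ desb (size b).+1 (wdes w) = b.
Proof.
exists (mkseq (fun j => count id (take j b)) (size b).+1); split.
  rewrite /monomial size_mkseq eqxx andbT; apply/(sortedP 0); rewrite size_mkseq => i il.
  rewrite !nth_mkseq //; last lia.
  by rewrite (take_nth false il) -cats1 count_cat leq_addr.
apply: (@eq_from_nth _ false); rewrite size_desb // => i ib.
rewrite (nth_map 0) ?size_iota // nth_iota // add1n /wdes -[i.+1.-1]/i !nth_mkseq //; last lia.
rewrite (take_nth false ib) -cats1 count_cat /= addn0.
by case: (nth _ _ _); rewrite /= ?addn1 ?addn0 ?ltnSn ?ltnn.
Qed.

Lemma sumn_countb (T : Type) (a : pred T) s : sumn [seq (a x : nat) | x <- s] = count a s.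
Proof. by elim: s => //= x s ->. Qed.

(** Turns an equality of power series into an equality of finite multisets, which can be computed
    with. *)
Lemma schur_multiset m la (T : Type) (Ds : T -> pred nat) (s : seq T) : is_partition m.+1 la ->
  (forall w, monomial m.+1 w -> sumn [seq (Qcoeff (Ds x) w : nat) | x <- s] = schur_coeff la w) ->
  exists2 v0, v0 \in allyam m.+1 &
    perm_eq [seq desb m.+1 (Ds x) | x <- s]
            [seq desb m.+1 (wdes v) | v <- allyam m.+1 & perm_eq v0 v].
Proof.
move=> pla h; have [v0 [yv0 sv0 cv0]] := partition_yam pla; exists v0.
  by rewrite mem_allyam yv0 sv0 eqxx.
apply: (@perm_bleq m).
  by rewrite all_cat !all_map !(eq_all (a2 := predT)) ?all_predT // => x /=; rewrite size_desb eqxx.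
move=> b sb; have [w [mw wb]] := strict_word b; rewrite sb in mw wb.
have := h w mw; rewrite sumn_countb; case/andP: (mw) => sw /eqP ew.
rewrite (schur_coeffE sw yv0) ?ew //; last by case/andP: pla => _ /eqP.
rewrite !count_map count_filter => e; rewrite -[LHS]/(count _ s).
transitivity (count (fun x => Qcoeff (Ds x) w) s).
  by apply: eq_count => x; rewrite /= Qcoeff_bleq ew wb.
by rewrite e; apply: eq_count => x; rewrite /= Qcoeff_bleq ew wb andbC.
Qed.

(** * Windows of small degree *)

(* The possible multisets of descent sets of a window of degree [m]; a shape occurs once for each of its tableaux. *)
Definition deslists (m : nat) : seq (seq bitseq) :=
  [seq [seq desb m (wdes v) | v <- allyam m & perm_eq v0 v] | v0 <- allyam m].

Definition allb (f : bool -> bool) : bool := f true && f false.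

Lemma allbP (f : bool -> bool) : reflect (forall x, f x) (allb f).
Proof.
by apply: (iffP andP) => [[? ?] []|h] //; rewrite !h.
Qed.

Lemma uniq_map_inj (A B : eqType) (f : A -> B) s : uniq (map f s) -> {in s &, injective f}.
Proof.
elim: s => //= x s IH /andP[fx us] y z; rewrite !inE => /orP[/eqP->|ys] /orP[/eqP->|zs] // e.
- by rewrite e map_f in fx.
- by rewrite -e map_f in fx.
- exact: IH.
Qed.

(* If [f2] changes [b4] and [b3], then [f2], [f3], [f4] agree on [T] and the class has only two elements.
   Otherwise the shape is (3,2) or (2,2,1) and [f2] changes both bits of another element. *)
Lemma window5_keeps_des (A : eqType) (f2 f3 f4 : A -> A) (b1 b2 b3 b4 : A -> bool) (Cl : seq A) :
  let bits T := [:: b1 T; b2 T; b3 T; b4 T] in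
  involutive f2 -> involutive f3 -> involutive f4 ->
  (forall T, b1 T = b2 T -> f2 T = T) ->
  (forall T, b1 T != b2 T -> b1 (f2 T) = ~~ b1 T /\ b2 (f2 T) = ~~ b2 T) ->
  (forall T, b3 (f2 T) != b3 T -> f2 T = f3 T) ->
  (forall T, b4 (f3 T) != b4 T -> f3 T = f4 T) ->
  (forall T, T \in Cl -> [/\ f2 T \in Cl, f3 T \in Cl & f4 T \in Cl]) ->
  (forall T, T \in Cl -> f2 T = f3 T -> f3 T = f4 T -> size Cl <= 2) ->
  has (fun L => perm_eq (map bits Cl) L) (deslists 5) ||
  has (fun L => perm_eq (map bits Cl) L) (map (map rev) (deslists 5)) ->
  forall T, T \in Cl -> b4 (f2 T) = b4 T.
Proof.
move=> bits i2 i3 i4 n2 a2 c1 c2 cl sz2 hL.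
have {hL}[L hL pL] : exists2 L, L \in deslists 5 ++ map (map rev) (deslists 5) & perm_eq (map bits Cl) L.
  by case/orP: hL => /hasP[L LL pL]; exists L; rewrite // mem_cat LL ?orbT.
have eL T : T \in Cl -> bits T \in L by move=> TC; rewrite -(perm_mem pL) map_f.
have flip3 T : T \in Cl -> b3 (f2 T) != b3 T -> b4 (f2 T) = b4 T.
  move=> TC d3; apply/eqP; apply: contraT => d4.
  have e23 := c1 T d3; have e34 : f3 T = f4 T by apply: c2; rewrite -e23.
  have := sz2 T TC e23 e34.
  have sL : size Cl = size L by rewrite -(perm_size pL) size_map.
  (* No shape of size 5 has exactly two standard tableaux. *)
  have : all (fun L : seq bitseq => (size L == 1) || (3 <= size L)) (deslists 5 ++ map (map rev) (deslists 5)).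
    by vm_compute.
  move/allP/(_ L hL); rewrite -sL => h h'.
  have : {subset [:: T; f2 T] <= Cl} by move=> U; rewrite !inE => /orP[]/eqP->//; case: (cl T TC).
  move/(uniq_leq_size (s1 := [:: T; f2 T])).
  rewrite /= inE andbT => /(_ _); have -> : T != f2 T by apply: contraNneq d3 => <-.
  by move=> /(_ isT); lia.
move=> T TC; apply/eqP; apply: contraT => d4.
have [/flip3|] := boolP (b3 (f2 T) != b3 T); first by move/(_ TC) => e; rewrite e eqxx in d4.
rewrite negbK => /eqP d3.
have [/eqP /n2 e|na] := boolP (b1 T == b2 T); first by rewrite e eqxx in d4.
have [e1 e2] := a2 T na.
have TL := eL T TC; have [f2C _ _] := cl T TC; have fL := eL _ f2C.
have b12 : b2 T = ~~ b1 T by move: na; case: (b1 T); case: (b2 T).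
have b4f : b4 (f2 T) = ~~ b4 T by move: d4; case: (b4 T); case: (b4 _).
rewrite /bits e1 e2 d3 b4f b12 negbK in fL; rewrite /bits b12 in TL.
have : all (fun L : seq bitseq => allb (fun x => allb (fun y => allb (fun z =>
    ([:: x; ~~ x; y; z] \in L) ==> ([:: ~~ x; x; y; ~~ z] \in L) ==>
      [&& [:: x; ~~ x; x; ~~ x] \in L, [:: x; ~~ x; x; ~~ x] != [:: x; ~~ x; y; z] &
         allb (fun y' => allb (fun z' =>
          ([:: ~~ x; x; y'; z'] \in L) ==> [|| [:: ~~ x; x; y'; z'] == [:: ~~ x; x; y; ~~ z],
          (y' == ~~ x) && (z' == x) | false]))]))))
    (deslists 5 ++ map (map rev) (deslists 5)).
  by vm_compute.
move/allP/(_ L hL)/allbP/(_ (b1 T))/allbP/(_ (b3 T))/allbP/(_ (b4 T)).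
rewrite TL fL /= => /and3P[cL cT /allbP cU].
have [U UC eU] : exists2 U, U \in Cl & bits U = [:: b1 T; ~~ b1 T; b1 T; ~~ b1 T].
  by move: cL; rewrite -(perm_mem pL) => /mapP[U UC eU]; exists U.
have [fUC _ _] := cl U UC.
have [u1 u2 u3 u4] : [/\ b1 U = b1 T, b2 U = ~~ b1 T, b3 U = b1 T & b4 U = ~~ b1 T] by case: eU.
have [v1 v2] : b1 (f2 U) = ~~ b1 U /\ b2 (f2 U) = ~~ b2 U by apply: a2; rewrite u1 u2; case: (b1 T).
have := eL _ fUC; rewrite /bits v1 v2 u1 u2 negbK => fUL.
(* Either [f2 U] has the bits of [f2 T], so that [U = T] against the bits of [U]; or [f2] changes
   both remaining bits of [U], against [flip3]. *)
move: (cU (b3 (f2 U))) => /allbP/(_ (b4 (f2 U))); rewrite fUL orbF /= => /orP[/eqP[e3 e4]|/andP[/eqP e3 /eqP e4]].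
  have uL : uniq L.
    have : all uniq (deslists 5 ++ map (map rev) (deslists 5)) by vm_compute.
    by move/allP/(_ L hL).
  rewrite -(perm_uniq pL) in uL; have inj := uniq_map_inj uL.
  have : U = T.
    by rewrite -(i2 U) -(i2 T); congr f2; apply: inj => //; rewrite /bits v1 v2 u1 u2 e1 e2 e3 e4 d3 b4f b12.
  by move=> eUT; move: eU cT; rewrite eUT /bits b12 => ->; rewrite eqxx.
have := flip3 U UC; rewrite e3 u3 e4 u4; case: (b1 T) => /(_ isT) //.
Qed.

(** * Which descents an involution can change *)

Section Local.
Variables (A : finType) (n : nat) (Des : A -> pred nat) (phi : nat -> A -> A).
Hypothesis Des_range : forall T d, Des T d -> 0 < d < n.
Hypothesis DE : is_dual_equivalence n Des phi.

Lemma phiK i : 1 < i < n -> involutive (phi i).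
Proof. by case: DE => h _; apply: h. Qed.

Lemma phiC i j T : 1 < i < n -> 1 < j < n -> (i + 3 <= j) || (j + 3 <= i) ->
  phi i (phi j T) = phi j (phi i T).
Proof. by case: DE => _ [_ h] i1 j1 ij; apply: h => //; case: (leqP i j) => ?; lia. Qed.

Notation cls := (@in_class A n phi).

Lemma cls_refl h i T : cls h i T T.
Proof. exact: connect0. Qed.

Lemma cls_trans h i T U V : cls h i T U -> cls h i U V -> cls h i T V.
Proof. exact: connect_trans. Qed.

Lemma cls_sym h i T U : cls h i T U = cls h i U T.
Proof.
apply: sym_connect_sym => x y; apply: eq_existsb => j; congr (_ && _); exact: orbC.
Qed.

Lemma cls_phi h i j T : h <= j <= i -> j < n -> cls h i T (phi j T).
Proof.
by move=> hj jn; apply: connect1; apply/existsP; exists (Ordinal jn); rewrite hj eqxx.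
Qed.

Lemma cls_sub h i h' i' T U : h' <= h -> i <= i' -> cls h i T U -> cls h' i' T U.
Proof.
move=> hh ii; apply: connect_sub => {T U} T U /existsP[j /andP[hj]].
case/orP=> /eqP->; first by apply: cls_phi => //; lia.
by rewrite -/(in_class n phi _ _ _ _) cls_sym; apply: cls_phi => //; lia.
Qed.

(** As the [phi j] are involutions, a backward step of the relation is also a forward step. *)
Lemma cls_ind h i (P : A -> Prop) T U : 1 < h ->
  (forall j V, h <= j <= i -> j < n -> P V -> P (phi j V)) -> P T -> cls h i T U -> P U.
Proof.
move=> h1 step + /connectP[p].
elim: p T => [|V p IH] T PT /=; first by move=> _ ->.
case/andP=> /existsP[j /andP[hj TV]] pV eU; apply: (IH V) => //.
case/orP: TV => /eqP e; first by rewrite e; apply: step.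
have j1 : 1 < j < n by rewrite ltn_ord andbT; lia.
by rewrite -[V](phiK j1) -e; apply: step.
Qed.

(** Descents among the [m] entries [a, ..., a + m - 1]; the involutions acting inside this window
    are [phi (a + 1), ..., phi (a + m - 2)]. *)
Definition wbits a m T : bitseq := [seq Des T j | j <- iota a m.-1].

Lemma window a m T : 0 < a -> 3 <= m <= 6 -> a + m <= n.+1 ->
  exists2 L, L \in deslists m &
    perm_eq [seq wbits a m U | U <- enum (cls a.+1 (a + m - 2) T)] L.
Proof.
move=> a0 m3 amn; case: DE => _ [h _].
have [||||la [pla hla]] := h a.+1 (a + m - 2) T; try lia.
have em : a + m - 2 - a.+1 + 3 = m.-1.+1 by lia.
rewrite em in pla hla.
have [|v0 v0m pv] := schur_multiset (Ds := Des_hi Des a.+1 (a + m - 2)) (s := enum (cls a.+1 (a + m - 2) T)) pla.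
  by move=> w mw; rewrite -(hla w mw) sumnE big_map big_enum.
have em' : m.-1.+1 = m by lia.
rewrite em' in pv v0m; exists [seq desb m (wdes v) | v <- allyam m & perm_eq v0 v].
  by apply/mapP; exists v0.
apply: perm_trans pv; rewrite (eq_map (g := fun U => desb m (Des_hi Des a.+1 (a + m - 2) U))) //.
move=> U; rewrite /wbits /desb.
have ea : a = a.-1 + 1 by lia.
rewrite {1}ea iotaDl -map_comp; apply/eq_in_map => j; rewrite mem_iota => hj /=.
have -> : a.-1 + j = j + (a.+1 - 2) by lia.
by rewrite /Des_hi; have -> : (0 < j) && (j <= a + m - 2 - a.+1 + 2) by lia.
Qed.

(** Only a few elements of a window class are usually known. That their bit vectors fit into one
    list is decidable and often pins down an unknown bit. *)
Lemma window_has a m T Us : 0 < a -> 3 <= m <= 6 -> a + m <= n.+1 ->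
  all (cls a.+1 (a + m - 2) T) Us ->
  has (fun L => all (mem L) [seq wbits a m U | U <- Us]) (deslists m).
Proof.
move=> a0 m3 amn hU; have [L hL pL] := window T a0 m3 amn.
apply/hasP; exists L => //; apply/allP => _ /mapP[U UUs ->] /=.
by rewrite -(perm_mem pL) map_f // mem_enum; apply: (allP hU).
Qed.

(** Up to size 5, distinct standard tableaux of one shape have distinct descent sets. *)
Lemma wbits_inj a m T U : 0 < a -> 3 <= m <= 5 -> a + m <= n.+1 ->
  cls a.+1 (a + m - 2) T U -> wbits a m T = wbits a m U -> T = U.
Proof.
move=> a0 m3 amn hU; have m6 : 3 <= m <= 6 by lia.
have [L hL pL] := window T a0 m6 amn.
have uL : uniq L.
  have : all (fun m => all uniq (deslists m)) [:: 3; 4; 5] by vm_compute.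
  by move/allP/(_ m) => h; apply: (allP (h _)) => //; rewrite !inE; lia.
rewrite -(perm_uniq pL) in uL; apply: (uniq_map_inj uL); rewrite mem_enum //; exact: cls_refl.
Qed.

(* In degree 6 the shape (3,2,1) has repeated descent sets, but {1,2,4} is not one of them. *)
Lemma wbits_inj6 a T U : 0 < a -> a + 6 <= n.+1 -> cls a.+1 (a + 4) T U ->
  wbits a 6 T = [:: true; true; false; true; false] -> wbits a 6 U = wbits a 6 T -> T = U.
Proof.
move=> a0 amn hU eT eU; have [|L hL pL] := window (m := 6) T a0 _ amn; first by [].
have : all (fun L => count_mem [:: true; true; false; true; false] L <= 1) (deslists 6) by vm_compute.
move/allP/(_ L hL); rewrite -(permP pL) count_map.
have e4 : a + 6 - 2 = a + 4 by lia.
rewrite e4 -size_filter; set s := filter _ _ => ss.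
have Ts : T \in s by rewrite mem_filter /= eT eqxx mem_enum; apply: cls_refl.
have Us : U \in s by rewrite mem_filter /= eU eT eqxx mem_enum.
by case: s ss Ts Us => [|x [|y s]] //= _; rewrite !inE => /eqP-> /eqP->.
Qed.

(** The window class of degree 3 is {[T], [phi i T]}, and the only shape of size 3 with two tableaux
    is (2,1), with descent sets {1} and {2}. *)
Lemma phi_flip i T : 1 < i < n ->
  if Des T i.-1 == Des T i then phi i T = T
  else Des (phi i T) i.-1 = ~~ Des T i.-1 /\ Des (phi i T) i = ~~ Des T i.
Proof.
move=> i1; have [|||L hL pL] := window (a := i.-1) (m := 3) T; try lia.
have e1 : i.-1.+1 = i by lia.
have e2 : i.-1 + 3 - 2 = i by lia.
have clsE U : cls i i T U -> (U == T) || (U == phi i T).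
  apply: (cls_ind (P := fun U => (U == T) || (U == phi i T))); rewrite ?eqxx //; first lia.
  move=> j V hj jn; have -> : j = i by lia.
  by case/orP=> /eqP->; rewrite ?phiK ?eqxx ?orbT.
have clsT := cls_refl i i T; have clsP : cls i i T (phi i T) by apply: cls_phi; lia.
have pe : perm_eq (enum (cls i.-1.+1 (i.-1 + 3 - 2) T)) (undup [:: T; phi i T]).
  apply: uniq_perm; rewrite ?enum_uniq ?undup_uniq // => U; rewrite mem_enum mem_undup !inE e1 e2.
  by apply/idP/idP => [/clsE//|/orP[]/eqP->].
have {pe} pm : perm_eq [seq wbits i.-1 3 U | U <- undup [:: T; phi i T]] L.
  by apply: perm_trans pL; rewrite perm_sym perm_map.
move: pm; rewrite /= inE /wbits /= e1; case: (eqVneq T (phi i T)) => [<-|ne] /= pm.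
  have : all (fun L => allb (fun x => allb (fun y => perm_eq [:: [:: x; y]] L ==> (x == y)))) (deslists 3) by vm_compute.
  by move/allP/(_ L hL)/allbP/(_ (Des T i.-1))/allbP/(_ (Des T i))/implyP/(_ pm) => ->.
have : all (fun L => allb (fun x => allb (fun y => allb (fun z => allb (fun t =>
   perm_eq [:: [:: x; y]; [:: z; t]] L ==> [&& x != y, z == ~~ x & t == ~~ y]))))) (deslists 3) by vm_compute.
move/allP/(_ L hL)/allbP/(_ (Des T i.-1))/allbP/(_ (Des T i)).
move/allbP/(_ (Des (phi i T) i.-1))/allbP/(_ (Des (phi i T) i))/implyP/(_ pm).
by case/and3P => /negPf-> /eqP-> /eqP->.
Qed.

Lemma phi_id i T : 1 < i < n -> Des T i.-1 = Des T i -> phi i T = T.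
Proof. by move=> i1 e; have := phi_flip T i1; rewrite e eqxx. Qed.

Lemma phi_neg i T : 1 < i < n -> Des T i.-1 != Des T i ->
  Des (phi i T) i.-1 = ~~ Des T i.-1 /\ Des (phi i T) i = ~~ Des T i.
Proof. by move=> i1 /negPf e; have := phi_flip T i1; rewrite e. Qed.

Lemma phi_neg' i T : 1 < i < n -> Des T i.-1 != Des T i ->
  [/\ Des T i.-1 = ~~ Des T i, Des (phi i T) i.-1 = Des T i & Des (phi i T) i = ~~ Des T i].
Proof.
move=> i1 ne; have [-> ->] := phi_neg i1 ne; split=> //; by move: ne; case: (Des T i.-1); case: (Des T i).
Qed.

(** All three bits of a degree 4 window change, which happens only in shape (2,2). It has two
    tableaux with complementary descent sets, and [phi h.+1] must exchange them too. *)
Lemma phi_eq_r h T : 1 < h -> h.+1 < n -> Des (phi h T) h.+1 != Des T h.+1 -> phi h T = phi h.+1 T.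
Proof.
move=> h1 hn ch; have ih : 1 < h < n by mlia.
have ih' : 1 < h.+1 < n by mlia.
have ne : Des T h.-1 != Des T h.
  by apply: contraNneq ch => e; rewrite (phi_id ih e).
have [e1 e2 e3] := phi_neg' ih ne.
have ah : h.-1.+1 = h by mlia.
have ah' : h.-1 + 4 - 2 = h.+1 by mlia.
have c2 : cls h h.+1 T (phi h T) by apply: cls_phi; mlia.
have c3 : cls h h.+1 T (phi h.+1 T) by apply: cls_phi; mlia.
have := @window_has h.-1 4 T [:: T; phi h T; phi h.+1 T].
rewrite ah ah' /= cls_refl c2 c3 /wbits /= ah => /(_ _ isT _ isT) H.
have {H} /hasP[L hL] : has (fun L => [&& [:: Des T h.-1; Des T h; Des T h.+1] \in L,
  [:: Des (phi h T) h.-1; Des (phi h T) h; Des (phi h T) h.+1] \in L,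
  [:: Des (phi h.+1 T) h.-1; Des (phi h.+1 T) h; Des (phi h.+1 T) h.+1] \in L & true]) (deslists 4) by apply: H; mlia.
rewrite e1 e2 e3 => HL.
have e4 : Des (phi h T) h.+1 = ~~ Des T h.+1 by move: ch; case: (Des T h.+1); case: (Des _ _).
rewrite e4 in HL.
apply: (wbits_inj (a := h.-1) (m := 4)) => //; try mlia.
  by rewrite ah ah'; apply: cls_trans c3; rewrite cls_sym.
rewrite /wbits /= ah e2 e3 e4.
have [eq|nq] := boolP (Des T h == Des T h.+1).
  have : all (fun L => allb (fun y => ~~ (([:: ~~ y; y; y] \in L) && ([:: y; ~~ y; ~~ y] \in L)))) (deslists 4) by vm_compute.
  by move/allP/(_ L hL)/allbP/(_ (Des T h)); case/and4P: HL; rewrite -(eqP eq) => -> ->.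
have [e5 e6 e7] := phi_neg' ih' nq; rewrite /= in e5 e6 e7.
have : all (fun L => allb (fun y => allb (fun w => ([:: ~~ y; y; ~~ y] \in L) ==> ([:: y; ~~ y; y] \in L) ==> ([:: w; ~~ y; y] \in L) ==> (w == y)))) (deslists 4) by vm_compute.
move/allP/(_ L hL)/allbP/(_ (Des T h))/allbP/(_ (Des (phi h.+1 T) h.-1)).
by rewrite e6 e7 e5 negbK in HL *; case/and4P: HL => -> -> -> _ /= /eqP->.
Qed.

(** Mirror image of [phi_eq_r]. *)
Lemma phi_eq_l h T : 1 < h -> h.+1 < n -> Des (phi h.+1 T) h.-1 != Des T h.-1 -> phi h.+1 T = phi h T.
Proof.
move=> h1 hn ch; have ih : 1 < h < n by mlia.
have ih' : 1 < h.+1 < n by mlia.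
have ne : Des T h.+1.-1 != Des T h.+1.
  by apply: contraNneq ch => e; rewrite (phi_id ih' e).
have [/= e1 e2 e3] := phi_neg' ih' ne.
have ah : h.-1.+1 = h by mlia.
have ah' : h.-1 + 4 - 2 = h.+1 by mlia.
have c2 : cls h h.+1 T (phi h T) by apply: cls_phi; mlia.
have c3 : cls h h.+1 T (phi h.+1 T) by apply: cls_phi; mlia.
have := @window_has h.-1 4 T [:: T; phi h T; phi h.+1 T].
rewrite ah ah' /= cls_refl c2 c3 /wbits /= ah => /(_ _ isT _ isT) H.
have {H} /hasP[L hL] : has (fun L => [&& [:: Des T h.-1; Des T h; Des T h.+1] \in L,
  [:: Des (phi h T) h.-1; Des (phi h T) h; Des (phi h T) h.+1] \in L,
  [:: Des (phi h.+1 T) h.-1; Des (phi h.+1 T) h; Des (phi h.+1 T) h.+1] \in L & true]) (deslists 4) by apply: H; mlia.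
rewrite e1 e2 e3 => HL.
have e4 : Des (phi h.+1 T) h.-1 = ~~ Des T h.-1 by move: ch; case: (Des T h.-1); case: (Des _ _).
rewrite e4 in HL.
apply: (wbits_inj (a := h.-1) (m := 4)) => //; try mlia.
  by rewrite ah ah'; apply: cls_trans c2; rewrite cls_sym.
rewrite /wbits /= ah e2 e3 e4.
have [eq|nq] := boolP (Des T h.-1 == Des T h).
  have : all (fun L => allb (fun y => ~~ (([:: ~~ y; ~~ y; y] \in L) && ([:: y; y; ~~ y] \in L)))) (deslists 4) by vm_compute.
  by move/allP/(_ L hL)/allbP/(_ (Des T h.+1)); case/and4P: HL; rewrite (eqP eq) e1 negbK => -> _ ->.
have [e5 e6 e7] := phi_neg' ih nq; rewrite /= in e5 e6 e7.
have : all (fun L => allb (fun y => allb (fun w => ([:: y; ~~ y; y] \in L) ==> ([:: ~~ y; y; ~~ y] \in L) ==> ([:: ~~ y; y; w] \in L) ==> (w == ~~ y)))) (deslists 4) by vm_compute.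
move/allP/(_ L hL)/allbP/(_ (Des T h.+1))/allbP/(_ (Des (phi h T) h.+1)).
by rewrite e6 e7 e5 e1 !negbK in HL *; case/and4P: HL => -> -> -> _ /= /eqP->.
Qed.

Lemma window5_small i j k T : 1 < i < n -> 1 < j < n -> 1 < k < n ->
  phi i T = phi j T -> phi j T = phi k T ->
  forall h l, 1 < h -> (forall m, h <= m <= l -> m \in [:: i; j; k]) ->
  size (enum (cls h l T)) <= 2.
Proof.
move=> i1 j1 k1 e1 e2 h l h1 hm; apply: (@uniq_leq_size _ _ [:: T; phi i T]); first exact: enum_uniq.
move=> U; rewrite mem_enum => /(cls_ind (P := fun U => U \in [:: T; phi i T]) h1); apply; last exact: mem_head.
move=> m V /hm; rewrite !inE => mm _ /orP[] /eqP->.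
  by case/or3P: mm => /eqP->; rewrite -?e2 -?e1 eqxx orbT.
by case/or3P: mm => /eqP->; rewrite ?[in phi j _]e1 ?[in phi k _]e1 ?[in phi k _]e2 phiK ?eqxx.
Qed.

Lemma keep_r i T : 1 < i < n -> Des (phi i T) (i + 2) = Des T (i + 2).
Proof.
move=> i1; case: (ltnP (i + 2) n) => i2; last first.
  by apply/idP/idP => /Des_range; mlia.
have [i1' i2' i3'] : [/\ 1 < i < n, 1 < i.+1 < n & 1 < i.+2 < n] by split; mlia.
have eT := cls_refl i i.+2 T.
rewrite addn2.
apply: (@window5_keeps_des _ (phi i) (phi i.+1) (phi i.+2) (fun T => Des T i.-1) (fun T => Des T i) (fun T => Des T i.+1)
  (fun T => Des T i.+2) (enum (cls i i.+2 T))); try exact: phiK; last by rewrite mem_enum.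
- by move=> U; apply: phi_id.
- by move=> U; apply: phi_neg.
- by move=> U; apply: phi_eq_r; mlia.
- by move=> U; apply: phi_eq_r; mlia.
- move=> U; rewrite !mem_enum => hU; split; apply: (cls_trans hU); apply: cls_phi; mlia.
- move=> U; rewrite mem_enum => hU e1 e2.
  have -> : enum (cls i i.+2 T) = enum (cls i i.+2 U).
    apply: eq_enum => V; apply/idP/idP; apply: cls_trans => //; by rewrite cls_sym.
  apply: (window5_small i1' i2' i3') => //; first mlia.
  by move=> m hm; rewrite !inE; mlia.
have [|||L hL pL] := window (a := i.-1) (m := 5) T; try mlia.
apply/orP; left; apply/hasP; exists L => //; move: pL; rewrite /wbits /=.
have -> : i.-1.+1 = i by mlia.
by have -> : i.-1 + 5 - 2 = i.+2 by mlia.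
Qed.

(** The argument of [keep_r] with the window read from right to left, which is why
    [window5_keeps_des] admits reversed lists. *)
Lemma keep_l i T : 3 < i < n -> Des (phi i T) (i - 3) = Des T (i - 3).
Proof.
move=> i1.
have [i1' i2' i3'] : [/\ 1 < i < n, 1 < i.-1 < n & 1 < i.-2 < n] by split; mlia.
have eT := cls_refl i.-2 i T.
have -> : i - 3 = i.-2.-1 by mlia.
apply: (@window5_keeps_des _ (phi i) (phi i.-1) (phi i.-2) (fun T => Des T i) (fun T => Des T i.-1) (fun T => Des T i.-2)
  (fun T => Des T i.-2.-1) (enum (cls i.-2 i T))); try exact: phiK; last by rewrite mem_enum.
- by move=> U e; apply: phi_id.
- by move=> U; rewrite eq_sym => /(phi_neg i1') [].
- move=> U; have := @phi_eq_l i.-1 U; have -> : i.-1.+1 = i by mlia.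
  by apply; mlia.
- move=> U; have := @phi_eq_l i.-2 U; have -> : i.-2.+1 = i.-1 by mlia.
  by apply; mlia.
- move=> U; rewrite !mem_enum => hU; split; apply: (cls_trans hU); apply: cls_phi; mlia.
- move=> U; rewrite mem_enum => hU e1 e2.
  have -> : enum (cls i.-2 i T) = enum (cls i.-2 i U).
    apply: eq_enum => V; apply/idP/idP; apply: cls_trans => //; by rewrite cls_sym.
  apply: (window5_small i1' i2' i3') => //; first mlia.
  by move=> m hm; rewrite !inE; mlia.
have [|||L hL pL] := window (a := i.-2.-1) (m := 5) T; try mlia.
apply/orP; right; apply/hasP; exists (map rev L); first exact: map_f.
move: pL; rewrite /wbits /=.
have -> : i.-2.-1 + 5 - 2 = i by mlia.
have -> : i.-2.-1.+1 = i.-2 by mlia.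
have -> : i.-2.+1 = i.-1 by mlia.
have -> : i.-1.+1 = i by mlia.
by move/(perm_map rev); rewrite -map_comp.
Qed.

(** [phi j.+1] commutes with [phi i] and fixes an element exactly when its bits [j] and [j + 1]
    agree, so an unchanged bit [j] forces an unchanged bit [j + 1]. *)
Lemma far_r i j T : 1 < i < n -> i + 2 <= j -> Des (phi i T) j = Des T j.
Proof.
move=> i1; elim: j => [|j IH]; first mlia.
rewrite leq_eqVlt => /orP[/eqP<-|ij]; first exact: keep_r.
have {}IH := IH ij; case: (ltnP j.+1 n) => jn; last by apply/idP/idP => /Des_range; mlia.
have j1 : 1 < j.+1 < n by mlia.
have c : phi i (phi j.+1 T) = phi j.+1 (phi i T) by apply: phiC; mlia.
have [e|ne] := boolP (Des T j == Des T j.+1).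
  have e' := phi_id j1 (eqP e); rewrite e' in c.
  apply/eqP; apply: contraT => ne; have : Des (phi i T) j.+1.-1 != Des (phi i T) j.+1.
    by rewrite /= IH (eqP e) eq_sym.
  by move/(phi_neg j1); rewrite -c /=; case=> h; move: (h); case: (Des _ j).
have [/= e1 e2 e3] := phi_neg' j1 ne.
apply/eqP; apply: contraT => ne'; have : Des (phi i T) j.+1.-1 = Des (phi i T) j.+1.
  by rewrite /= IH e1; move: ne'; case: (Des T j.+1); case: (Des _ _).
move/(phi_id j1) => e4; rewrite e4 in c.
have e5 : phi j.+1 T = T by apply: (can_inj (phiK i1)).
by move: e3; rewrite e5; case: (Des T j.+1).
Qed.

(** The same propagation downwards from [i - 3], by induction on the distance [k]. *)
Lemma far_l i j T : 1 < i < n -> j + 3 <= i -> Des (phi i T) j = Des T j.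
Proof.
move=> i1 ji; have [k ek] : exists k, j + k = i - 3 by exists (i - 3 - j); mlia.
elim: k j ji ek => [|k IH] j ji ek.
  case: (posnP j) => [->|j0]; first by apply/idP/idP => /Des_range; mlia.
  have -> : j = i - 3 by mlia.
  by apply: keep_l; mlia.
case: (posnP j) => [->|j0]; first by apply/idP/idP => /Des_range; mlia.
have {}IH : Des (phi i T) j.+1 = Des T j.+1 by apply: IH; mlia.
have j1 : 1 < j.+1 < n by mlia.
have c : phi i (phi j.+1 T) = phi j.+1 (phi i T) by apply: phiC; mlia.
have [e|ne] := boolP (Des T j == Des T j.+1).
  have e' := phi_id j1 (eqP e); rewrite e' in c.
  apply/eqP; apply: contraT => ne; have : Des (phi i T) j.+1.-1 != Des (phi i T) j.+1.
    by rewrite /= IH -(eqP e).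
  by move/(phi_neg j1); rewrite -c /=; case=> h; move: (h); case: (Des _ j).
have [/= e1 e2 e3] := phi_neg' j1 ne.
apply/eqP; apply: contraT => ne'; have : Des (phi i T) j.+1.-1 = Des (phi i T) j.+1.
  by rewrite /= IH; move: ne'; rewrite e1; case: (Des T j.+1); case: (Des _ _).
move/(phi_id j1) => e4; rewrite e4 in c.
have e5 : phi j.+1 T = T by apply: (can_inj (phiK i1)).
by move: e3; rewrite e5; case: (Des T j.+1).
Qed.
End Local.

(** * The action of the last involution *)

(* The five vectors are the descents of [T0], [T1], [T2], [phi k T0] and [Z] in [swaplast_third];
   lying in a common list forces the unknown bit [x]. *)
Lemma third_letter_bits ge p y z x :
  (ge ==> p ==> y) && (~~ ge ==> ~~ p ==> ~~ y) && (ge ==> ~~ p ==> z) && (~~ ge ==> p ==> ~~ z) ->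
  has (fun L => all (mem L) [:: [:: ~~ ge; ge; p; ~~ p]; [:: ge; ~~ ge; y; ~~ p];
    (if ~~ ge == y then [:: ge; ~~ ge; y; ~~ p] else if p == ~~ ge then [:: ~~ ge; ge; p; ~~ p] else [:: ge; p; ~~ y; z]);
    [:: ~~ ge; ge; ~~ p; p]; [:: ge; ~~ ge; x; p]]) (deslists 5) ->
  x = z.
Proof.
have : allb (fun ge => allb (fun p => allb (fun y => allb (fun z => allb (fun x =>
  (ge ==> p ==> y) && (~~ ge ==> ~~ p ==> ~~ y) && (ge ==> ~~ p ==> z) && (~~ ge ==> p ==> ~~ z) ==>
  has (fun L => all (mem L) [:: [:: ~~ ge; ge; p; ~~ p]; [:: ge; ~~ ge; y; ~~ p];
    (if ~~ ge == y then [:: ge; ~~ ge; y; ~~ p] else if p == ~~ ge then [:: ~~ ge; ge; p; ~~ p] else [:: ge; p; ~~ y; z]);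
    [:: ~~ ge; ge; ~~ p; p]; [:: ge; ~~ ge; x; p]]) (deslists 5) ==> (x == z)))))) by vm_compute.
move/allbP/(_ ge)/allbP/(_ p)/allbP/(_ y)/allbP/(_ z)/allbP/(_ x) => /implyP h1 h2.
by move: (h1 h2) => /implyP h3 h4; apply/eqP/h3.
Qed.

(** The vectors are the descents of [T0], [phi k T0] and [W] in [swaplast_fourth], with [p] standing
    for [e < d]. *)
Lemma fourth_letter_bits4 p x :
  has (fun L => all (mem L) [:: [:: p; p; ~~ p]; [:: p; ~~ p; p]; [:: ~~ p; p; x]]) (deslists 4) -> x = p.
Proof.
have : allb (fun p => allb (fun x =>
  has (fun L => all (mem L) [:: [:: p; p; ~~ p]; [:: p; ~~ p; p]; [:: ~~ p; p; x]]) (deslists 4) ==> (x == p))) by vm_compute.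
by move/allbP/(_ p)/allbP/(_ x)/implyP => h /h/eqP.
Qed.

(** The vectors belong to [T0], [T1], [phi k T0], [Z] and [V] in [swaplast_fourth]; [p], [y], [x]
    stand for [e < d], [g < d], [g < c']. *)
Lemma fourth_letter_bits5 p y x :
  has (fun L => all (mem L) [:: [:: p; ~~ p; p; ~~ p]; [:: ~~ p; p; y; ~~ p];
    [:: p; ~~ p; ~~ p; p]; [:: ~~ p; p; ~~ p; p]; [:: ~~ p; ~~ p; p; x]]) (deslists 5) -> x = y.
Proof.
have : allb (fun p => allb (fun y => allb (fun x =>
  has (fun L => all (mem L) [:: [:: p; ~~ p; p; ~~ p]; [:: ~~ p; p; y; ~~ p];
    [:: p; ~~ p; ~~ p; p]; [:: ~~ p; p; ~~ p; p]; [:: ~~ p; ~~ p; p; x]]) (deslists 5) ==> (x == y)))) by vm_compute.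
by move/allbP/(_ p)/allbP/(_ y)/allbP/(_ x)/implyP => h /h/eqP.
Qed.

Section Step.
Variables (A : finType) (n : nat) (Des : A -> pred nat) (phi : nat -> A -> A).
Hypothesis Des_range : forall T d, Des T d -> 0 < d < n.
Hypothesis DE : is_dual_equivalence n Des phi.
Notation cls := (@in_class A n phi).

Definition act (s : seq nat) (T : A) : A := foldl (fun x j => phi j x) T s.

Lemma act_rcons s j T : act (rcons s j) T = phi j (act s T).
Proof. by rewrite /act -cats1 foldl_cat. Qed.

Lemma act_cls h i s T : all (fun j => (h <= j <= i) && (j < n)) s -> cls h i T (act s T).
Proof.
elim: s T => [|j s IH] T /=; first by rewrite cls_refl.
by case/andP=> /andP[hj jn] hs; apply: cls_trans (IH _ hs); apply: cls_phi.
Qed.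

Lemma act_phi s j T : 1 < j < n -> all (fun i => (1 < i < n) && (i + 3 <= j)) s ->
  act s (phi j T) = phi j (act s T).
Proof.
move=> j1; elim: s T => //= i s IH T /andP[/andP[i1 ij] hs].
by rewrite (phiC DE) ?ij // IH.
Qed.

(** The words have [k + 1] letters, but [phi i] is known to act as [dd i] only for [i < k]. For
    [phi k] itself, [takeP] confines the change to the last three letters. *)
Variables (k : nat) (P : A -> seq nat).
Hypothesis k1 : 1 < k < n.
Hypothesis sizeP : forall T, size (P T) = k.+1.
Hypothesis yamPP : forall T, yam (P T).
Hypothesis desP : forall T i, 0 < i <= k -> Des T i = wdes (P T) i.
Hypothesis ddP : forall T i, 1 < i < k -> P (phi i T) = dd i (P T).
Hypothesis injP : forall T U, cls 2 k.-1 T U -> P T = P U -> T = U.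
Hypothesis takeP : forall T j, 1 < j < n -> take (j - 2) (P (phi j T)) = take (j - 2) (P T).

Lemma act_dact s T : all (fun i => 1 < i < k) s -> P (act s T) = dact s (P T).
Proof.
by elim: s T => //= i s IH T /andP[ik hs]; rewrite IH // ddP.
Qed.

Lemma act_clsk s T : all (fun i => 1 < i < k) s -> cls 2 k.-1 T (act s T).
Proof. by move=> hs; apply: act_cls; apply: sub_all hs => i; mlia. Qed.

(** Connectedness applied to the prefix. It serves to bring a chosen corner next to the letters
    under study. *)
Lemma lift_word u r v T : P T = u ++ r -> yam v -> perm_eq u v -> size u <= k ->
  exists2 s, all (fun i => 1 < i < size u) s & P (act s T) = v ++ r.
Proof.
move=> eP yv uv su; have yu : yam u by apply: (@yam_catl _ r); rewrite -eP.
have [s hs es] := yam_connected yu yv uv; exists s => //.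
by rewrite act_dact ?(all_lt_widen su) // eP dact_catr // es.
Qed.

Lemma wbitsP t r T : P T = t ++ r -> wbits Des (size t).+1 (size r) T = desb (size r) (wdes r).
Proof.
move=> eP; have sz := sizeP T; rewrite eP size_cat in sz.
rewrite /wbits /desb -addn1 iotaDl -map_comp; apply/eq_in_map => j; rewrite mem_iota => hj /=.
rewrite desP; last mlia.
rewrite eP /wdes !nth_cat.
have -> : (size t + j < size t) = false by mlia.
have -> : ((size t + j).-1 < size t) = false by mlia.
by congr (nth _ _ _ < nth _ _ _); mlia.
Qed.

Lemma ddPw t r T i : P T = t ++ r -> 1 < i < (size r).-1 -> P (phi (size t + i) T) = t ++ dd i r.
Proof.
move=> eP hi; have sz := sizeP T; rewrite eP size_cat in sz.
by rewrite ddP; [rewrite eP dd_shift //|]; mlia.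
Qed.

(* The Knuth move on [e d c] exchanges the last two letters. *)
Definition swaps_last (e d c : nat) : bool := ((e < d) != (d < c)) && ((e < c) == (d < c)).

Lemma act_phik s (u : seq nat) T : size u + 2 = k -> all (fun i => 1 < i < size u) s ->
  act s (phi k T) = phi k (act s T).
Proof. by move=> uk hs; apply: act_phi => //; apply: sub_all hs => i; mlia. Qed.

Lemma phik_flip T u e d c : P T = u ++ [:: e; d; c] -> (e < d) != (d < c) ->
  Des (phi k T) k.-1 = (d < c) /\ Des (phi k T) k = (e < d).
Proof.
move=> eP ne; have := wbitsP eP; rewrite /wbits /= => -[e1 e2].
have uk : size u + 2 = k by have := sizeP T; rewrite eP size_cat /=; mlia.
have ek : (size u).+1 = k.-1 by mlia.
have ek' : k.-1.+1 = k by mlia.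
rewrite ek ek' /wdes /= in e1 e2.
have := @phi_neg _ _ _ _ DE k T k1; rewrite e1 e2 => /(_ ne) [-> ->].
by move: ne; case: (e < d); case: (d < c).
Qed.

Lemma phik_suffix T u r : P T = u ++ r -> size r = 3 ->
  exists x y z, P (phi k T) = u ++ [:: x; y; z].
Proof.
move=> eP sr; have uk : size u + 2 = k by have := sizeP T; rewrite eP size_cat sr; mlia.
have := takeP T k1; have -> : k - 2 = size u by mlia.
rewrite eP take_size_cat // => tu.
have := sizeP (phi k T); rewrite -(cat_take_drop (size u) (P (phi k T))) tu size_cat.
case: (drop _ _) => [|x [|y [|z [|? ?]]]] /=; try mlia.
by exists x, y, z.
Qed.

(** Once [u] is rearranged to end in a witness [f] for [d] and [e], [phi k.-1] exchanges them and
    thereby changes the descent at [k], so it equals [phi k] by [phi_eq_r]. The rearrangement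
    commutes with [phi k], which carries the result back to [T]. *)
Lemma swapfirst T u e d c : P T = u ++ [:: e; d; c] -> (e < d) != (d < c) -> (e < c) == (e < d) ->
  P (phi k T) = u ++ [:: d; e; c] /\ cls 2 k.-1 T (phi k T).
Proof.
move=> eP ne ce; have uk : size u + 2 = k by have := sizeP T; rewrite eP size_cat /=; mlia.
have yT := yamPP T; rewrite eP in yT.
have e3 a b x : u ++ [:: a; b; x] = rcons (rcons (rcons u a) b) x by rewrite -!cats1 -!catA.
have yT2 : yam (dd k (u ++ [:: e; d; c])) by apply: yam_dd => //; rewrite size_cat /=; mlia.
rewrite dd_cat ?(negPf ne) ?ce in yT2; last mlia.
move: yT yT2; rewrite !e3 !yam_rcons => /andP[/andP[/andP[yu ae] _] _] /andP[/andP[/andP[_ ad] _] _].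
have de : d != e by move: ne ce; clear; lia.
have [t yt tu] := between_yam yu ad ae de; set f := (maxn d e).-1 in yt tu.
have su : size u <= k by mlia.
have ut : perm_eq u (rcons t f) by rewrite perm_sym.
have [s hs eT0] := lift_word eP yt ut su; set T0 := act s T in eT0.
have st : (size t).+1 = size u by rewrite -(perm_size tu) size_rcons.
have e4 a b x : rcons t f ++ [:: a; b; x] = t ++ [:: f; a; b; x] by rewrite -cats1 -catA.
rewrite e4 in eT0.
pose T1 := phi (size t + 2) T0.
have eT1 : P T1 = t ++ [:: f; d; e; c].
  rewrite /T1 (ddPw eT0) //= /dd /=; congr (_ ++ _).
  have -> : (f < e) == (e < d) = false by rewrite /f; move: de; clear; lia.
  by have -> : (f < d) == (f < e) = false by rewrite /f; move: de; clear; lia.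
have ek : size t + 2 = k.-1 by mlia.
have ek' : k.-1.+1 = k by mlia.
have e10 : T1 = phi k T0.
  rewrite /T1 ek -{2}ek'; apply: (phi_eq_r DE); rewrite ?ek'; try mlia.
  have := wbitsP eT0; have := wbitsP eT1; rewrite /wbits /= => -[_ _ x1] [_ _ x2].
  have e5 : (size t).+3 = k by mlia.
  rewrite -ek -/T1 -e5 x1 x2 /wdes /=; by move: ne ce; clear; case: (e < d); case: (d < c); case: (e < c).
have c01 : cls 2 k.-1 T0 T1 by apply: cls_phi; mlia.
have cT0 : cls 2 k.-1 T T0 by apply: act_clsk; apply: all_lt_widen hs.
have eA : act s (phi k T) = T1 by rewrite e10; apply: (act_phik _ uk hs).
have cP : cls 2 k.-1 (phi k T) T1 by rewrite -eA; apply: act_clsk; apply: all_lt_widen hs.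
split; last by apply: cls_trans cT0 _; apply: cls_trans c01 _; rewrite cls_sym.
have [x [y [z eQ]]] := phik_suffix eP erefl.
have := act_dact (phi k T) (all_lt_widen su hs); rewrite eA eT1 eQ dact_catr //.
by rewrite -cat_rcons => /eqP; rewrite eqseq_cat ?size_dact ?size_rcons // => /andP[_ /eqP[-> -> ->]].
Qed.

(* Otherwise [phi k] and [phi k.-1] agree on [T], and bit [k] of [phi k.-1 T] is known. *)
Lemma swaplast_des T u e d c : P T = u ++ [:: e; d; c] -> swaps_last e d c ->
  Des (phi k T) (k - 2) = Des T (k - 2).
Proof.
move=> eP /andP[ne ce]; have uk : size u + 2 = k by have := sizeP T; rewrite eP size_cat /=; mlia.
case: (posnP (size u)) => su.
  have -> : k - 2 = 0 by mlia.
  by apply/idP/idP => /Des_range.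
case/lastP: u su eP uk => // t f _; rewrite size_rcons -cats1 -catA => eP uk.
apply/eqP; apply: contraT => nd.
have ek' : k.-1.+1 = k by mlia.
have ek2 : k.-1.-1 = k - 2 by mlia.
have := @phi_eq_l _ _ _ _ DE k.-1 T; rewrite ek' ek2 => /(_ _ _ nd) eqk.
have {}eqk : phi k T = phi k.-1 T by apply: eqk; mlia.
have [_ f2] := phik_flip (u := rcons t f) (T := T) (etrans eP (esym (cat_rcons _ _ _))) ne.
have ek : size t + 2 = k.-1 by mlia.
have e1 := @ddPw t _ T 2 eP isT; rewrite ek -eqk in e1.
have := wbitsP e1; have e5 : (size t).+3 = k by mlia.
have -> : size (dd 2 [:: f; e; d; c]) = 4 by rewrite size_dd.
rewrite /wbits /= => -[_ _]; rewrite e5 f2 /dd /wdes /=; move: ne ce; clear.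
by case: ((f < e) == (e < d)); case: ((f < d) == (f < e)) => /=; case: (e < d); case: (d < c); case: (e < c).
Qed.

(** Any corner [g] of [u] can be moved to the end of [u], where the descent at [k - 2] compares it
    with the next letter. This descent is kept by [swaplast_des], and [addable_inj] applies. *)
Lemma phik_prefix T u e d c : P T = u ++ [:: e; d; c] -> swaps_last e d c ->
  exists d' c', P (phi k T) = u ++ [:: e; d'; c'].
Proof.
move=> eP sw; have uk : size u + 2 = k by have := sizeP T; rewrite eP size_cat /=; mlia.
have [e' [d' [c' eQ]]] := phik_suffix eP erefl; exists d', c'; rewrite eQ; congr (_ ++ _ :: _).
have e3 a b x : u ++ [:: a; b; x] = rcons (rcons (rcons u a) b) x by rewrite -!cats1 -!catA.
have := yamPP T; have := yamPP (phi k T); rewrite eP eQ !e3 !yam_rcons.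
move=> /andP[/andP[/andP[yu ae'] _] _] /andP[/andP[/andP[_ ae] _] _].
apply: (addable_inj (v := u)) => // g gu.
have [v yv vu] := corner_yam (yam_partc yu) gu.
have su : size u <= k by mlia.
have uv : perm_eq u (rcons v g) by rewrite perm_sym.
have [s hs eT0] := lift_word eP yv uv su.
have sv : (size v).+1 = size u by rewrite -(perm_size vu) size_rcons.
have := act_dact (phi k T) (all_lt_widen su hs).
have := act_dact T (all_lt_widen su hs); rewrite eT0 eP dact_catr // => /eqP.
rewrite eqseq_cat ?size_dact ?size_rcons // => /andP[/eqP es _].
rewrite eQ dact_catr // -es (act_phik _ uk hs) cat_rcons => eZ.
rewrite cat_rcons in eT0.
have := swaplast_des (u := rcons v g) (etrans eT0 (esym (cat_rcons _ _ _))) sw.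
have -> : k - 2 = (size v).+1 by mlia.
have := wbitsP eZ; have := wbitsP eT0; rewrite /wbits /= => -[-> _ _] [-> _ _].
by rewrite /wdes.
Qed.

(** Moves of the prefix commute with [phi k], so its effect on the last three letters can be studied
    for any convenient prefix. *)
Lemma lift_phik T u v r r' : P T = u ++ r -> P (phi k T) = u ++ r' -> size u + 2 = k ->
  yam v -> perm_eq u v -> exists T0, P T0 = v ++ r /\ P (phi k T0) = v ++ r'.
Proof.
move=> eP eQ uk yv uv; have su : size u <= k by mlia.
have [s hs eT0] := lift_word eP yv uv su; exists (act s T); split=> //.
rewrite -(act_phik _ uk hs) act_dact ?(all_lt_widen su hs) // eQ dact_catr //; congr (_ ++ _).
have := act_dact T (all_lt_widen su hs); rewrite eT0 eP dact_catr // => /eqP.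
by rewrite eqseq_cat ?size_dact ?(perm_size uv) // => /andP[/eqP-> _].
Qed.

Lemma corner_lift T u e d c d' c' g : P T = u ++ [:: e; d; c] ->
  P (phi k T) = u ++ [:: e; d'; c'] ->
  cnt g.+1 (rcons u e) < cnt g (rcons u e) -> e != g ->
  exists t T0, P T0 = t ++ [:: (maxn e g).-1; g; e; d; c] /\
               P (phi k T0) = t ++ [:: (maxn e g).-1; g; e; d'; c'].
Proof.
move=> eP eQ gu eg; have uk : size u + 2 = k by have := sizeP T; rewrite eP size_cat /=; mlia.
have yue : yam (rcons u e).
  by apply: (@yam_catl _ [:: d; c]); rewrite cat_rcons -eP.
have [v yv vu] := corner_yam (yam_partc yue) gu.
have vu' : perm_eq (rcons u e) (rcons v g) by rewrite perm_sym.
have [t] := two_corners yue yv vu' eg; set h := (maxn e g).-1 => /= -[ytge yteg ptu].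
have thg : perm_eq u (t ++ [:: h; g]).
  by rewrite -(perm_rcons2 e) (perm_trans ptu) // -cats1 -catA.
have ythg : yam (t ++ [:: h; g]) by apply: (@yam_catl _ [:: e]); rewrite -catA.
have [T0 []] := lift_phik eP eQ uk ythg thg.
by rewrite -!catA; exists t, T0.
Qed.

(** [d'] is compared with each corner [g] of [rcons u e]. The descent at [k - 1] settles [g = e].
    Otherwise [u] is made to end in [h g], so that [phi (k - 2)] exchanges [g] and [e], and a window
    of degree 5 leaves one value for [g < d']. *)
Lemma swaplast_third T u e d c d' c' : P T = u ++ [:: e; d; c] -> swaps_last e d c ->
  P (phi k T) = u ++ [:: e; d'; c'] -> d' = c.
Proof.
move=> eP sw eQ; have /andP[ne ce] := sw.
have uk : size u + 2 = k by have := sizeP T; rewrite eP size_cat /=; mlia.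
have e3 a b x : u ++ [:: a; b; x] = rcons (rcons (rcons u a) b) x by rewrite -!cats1 -!catA.
have yT := yamPP T; rewrite eP in yT.
have yT2 : yam (dd k (u ++ [:: e; d; c])) by apply: yam_dd => //; rewrite size_cat /=; mlia.
have ne' : ((e < c) == (e < d)) = false.
  by move: ne ce; clear; case: (e < d); case: (d < c); case: (e < c).
rewrite dd_cat ?(negPf ne) ?ne' in yT2; last mlia.
have [f1 f2] := phik_flip eP ne.
have := wbitsP eQ; rewrite /wbits /=.
have ek : (size u).+1 = k.-1 by mlia.
have ek' : k.-1.+1 = k by mlia.
rewrite ek ek' f1 f2 /wdes /= => -[b1 b2].
move: yT yT2 (yamPP (phi k T)); rewrite eQ !e3 !yam_rcons.
move=> /andP[/andP[/andP[yu ae] ad] ac] /andP[/andP[_ acu] _] /andP[/andP[_ ad'] _].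
have yue : yam (rcons u e) by rewrite yam_rcons yu.
apply: (addable_inj (v := rcons u e)) => // g gu.
case: (eqVneq e g) => [<-|eg]; first by rewrite -b1 (eqP ce).
have [t [T0]] := corner_lift eP eQ gu eg; set h := (maxn e g).-1 => -[eT0 eT0'].
have st : size t + 5 = k.+1 by have := sizeP T0; rewrite eT0 size_cat.
pose T1 := phi (size t + 2) T0; pose T2 := phi (size t + 3) T1; pose Z := phi (size t + 2) (phi k T0).
have hg : (h < g) = ~~ (g < e) by rewrite /h; move: eg; clear; lia.
have he : (h < e) = (g < e) by rewrite /h; move: eg; clear; lia.
have eg' : (e < g) = ~~ (g < e) by move: eg; clear; lia.
have nb : (~~ (g < e)) == (g < e) = false by case: (g < e).
have nb' : (g < e) == ~~ (g < e) = false by case: (g < e).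
have swz x y : dd 2 [:: h; g; e; x; y] = [:: h; e; g; x; y].
  by rewrite /dd /= hg he nb eq_sym nb.
have eT1 : P T1 = t ++ [:: h; e; g; d; c] by rewrite (ddPw eT0) // swz.
have eZ : P Z = t ++ [:: h; e; g; d'; c'] by rewrite (ddPw eT0') // swz.
have eT2 : P T2 = t ++ dd 3 [:: h; e; g; d; c] by rewrite (ddPw eT1).
have st4 : size t + 4 = k by mlia.
have inw j U : size t + 2 <= j <= size t + 4 -> cls (size t).+2 ((size t).+1 + 5 - 2) U (phi j U).
  by move=> hj; apply: cls_phi; mlia.
have c1 : cls (size t).+2 ((size t).+1 + 5 - 2) T0 T1 by apply: inw; mlia.
have c2 : cls (size t).+2 ((size t).+1 + 5 - 2) T0 T2 by apply: cls_trans c1 _; apply: inw; mlia.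
have c3 : cls (size t).+2 ((size t).+1 + 5 - 2) T0 (phi k T0) by apply: inw; mlia.
have c4 : cls (size t).+2 ((size t).+1 + 5 - 2) T0 Z by apply: cls_trans c3 _; apply: inw; mlia.
have := @window_has _ _ _ _ DE (size t).+1 5 T0 [:: T0; T1; T2; phi k T0; Z] isT isT.
rewrite [all _ _]/= cls_refl c1 c2 c3 c4 => /(_ _ isT) H.
have {H} := H _; rewrite [map _ _]/=.
rewrite (wbitsP eT0) (wbitsP eT1) (wbitsP eT0') (wbitsP eZ).
have := wbitsP eT2; rewrite size_dd => ->.
have -> : desb 5 (wdes [:: h; g; e; d; c]) = [:: ~~ (g < e); g < e; e < d; ~~ (e < d)].
  by rewrite /desb /wdes /= hg; congr [:: _; _; _; _]; move: ne; case: (e < d); case: (d < c).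
have -> : desb 5 (wdes [:: h; e; g; d; c]) = [:: g < e; ~~ (g < e); g < d; ~~ (e < d)].
  by rewrite /desb /wdes /= he eg'; congr [:: _; _; _; _]; move: ne; case: (e < d); case: (d < c).
have b1' : (e < d') = ~~ (e < d) by rewrite -b1; move: ne; case: (e < d); case: (d < c).
have -> : desb 5 (wdes [:: h; g; e; d'; c']) = [:: ~~ (g < e); g < e; ~~ (e < d); e < d].
  by rewrite /desb /wdes /= hg b1' -b2.
have -> : desb 5 (wdes [:: h; e; g; d'; c']) = [:: g < e; ~~ (g < e); g < d'; e < d].
  by rewrite /desb /wdes /= he eg' -b2.
have -> : desb 5 (wdes (dd 3 [:: h; e; g; d; c])) =
   if ~~ (g < e) == (g < d) then [:: g < e; ~~ (g < e); g < d; ~~ (e < d)]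
   else if (e < d) == ~~ (g < e) then [:: ~~ (g < e); g < e; e < d; ~~ (e < d)] else [:: g < e; e < d; ~~ (g < d); g < c].
  rewrite /dd /= eg'; case: ifP => n1 /=.
    by rewrite /desb /wdes /= he eg'; congr [:: _; _; _; _]; move: ne; case: (e < d); case: (d < c).
  case: ifP => n2 /=.
    by rewrite /desb /wdes /= hg; congr [:: _; _; _; _]; move: ne; case: (e < d); case: (d < c).
  rewrite /desb /wdes /= he; congr [:: _; _; _; _].
  by move: ne ce eg n1 n2; clear; lia.
move=> H; apply: (third_letter_bits _ (H _)); last by mlia.
by move: ne ce eg; clear; lia.
Qed.

(** The same comparison for the last letter, with the corners of [u e c]: the descent at [k] settles
    [g = c], a window of degree 4 settles [g = e], and a window of degree 5 those [g] for which
    transitivity is not enough. *)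
Lemma swaplast_fourth T u e d c c' : P T = u ++ [:: e; d; c] -> swaps_last e d c ->
  P (phi k T) = u ++ [:: e; c; c'] -> c' = d.
Proof.
move=> eP sw eQ; have /andP[ne ce] := sw.
have uk : size u + 2 = k by have := sizeP T; rewrite eP size_cat /=; mlia.
have e3 a b x : u ++ [:: a; b; x] = rcons (rcons (rcons u a) b) x by rewrite -!cats1 -!catA.
have yT := yamPP T; rewrite eP in yT.
have yT2 : yam (dd k (u ++ [:: e; d; c])) by apply: yam_dd => //; rewrite size_cat /=; mlia.
have ne' : ((e < c) == (e < d)) = false.
  by move: ne ce; clear; case: (e < d); case: (d < c); case: (e < c).
rewrite dd_cat ?(negPf ne) ?ne' in yT2; last mlia.
have [f1 f2] := phik_flip eP ne.
have := wbitsP eQ; rewrite /wbits /=.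
have ek : (size u).+1 = k.-1 by mlia.
have ek' : k.-1.+1 = k by mlia.
rewrite ek ek' f1 f2 /wdes /= => -[b1 b2].
have yQ := yamPP (phi k T); rewrite eQ in yQ.
move: (yT2) (yQ); rewrite !e3 !yam_rcons => /andP[/andP[/andP[yu ae] ac] ad] /andP[_ ac'].
have yue : yam (rcons u e) by rewrite yam_rcons yu.
have yuec : yam (rcons (rcons u e) c) by rewrite yam_rcons yue.
have pe : (e < d) = ~~ (d < c) by move: ne; case: (e < d); case: (d < c).
have ltce : e != c -> (c < e) = (e < d) by move: ne ce; clear; lia.
have lt_e : e != c -> cnt e.+1 (rcons (rcons u e) c) < cnt e (rcons (rcons u e) c) -> (e < c') = (e < d).
  move=> nec gu; have [v yv vu] := corner_yam (yam_partc yuec) gu.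
  have vu' : perm_eq (rcons (rcons u e) c) (rcons v e) by rewrite perm_sym.
  have nce : c != e by rewrite eq_sym.
  have [t] := two_corners yuec yv vu' nce; set f := (maxn c e).-1 => /= -[ytec ytce ptu].
  have tf : perm_eq u (t ++ [:: f]).
    by rewrite -(perm_rcons2 e) -(perm_rcons2 c) (perm_trans ptu) // -!cats1 -!catA.
  have ytf : yam (t ++ [:: f]) by apply: (@yam_catl _ [:: e; c]); rewrite -catA.
  have [T0 []] := lift_phik eP eQ uk ytf tf; rewrite -!catA /= => eT0 eT0'.
  have st : size t + 4 = k.+1 by have := sizeP T0; rewrite eT0 size_cat.
  pose W := phi (size t + 2) (phi k T0).
  have fe : (f < e) = (c < e) by rewrite /f; move: nce; clear; lia.
  have fc : (f < c) = (e < c) by rewrite /f; move: nce; clear; lia.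
  have ec : (e < c) = ~~ (c < e) by move: nce; clear; lia.
  have eW : P W = t ++ [:: f; c; e; c'].
    by rewrite (ddPw eT0') // /dd /= fe fc ec; case: (c < e).
  have c3 : cls (size t).+2 ((size t).+1 + 4 - 2) T0 (phi k T0) by apply: cls_phi; mlia.
  have c4 : cls (size t).+2 ((size t).+1 + 4 - 2) T0 W by apply: cls_trans c3 _; apply: cls_phi; mlia.
  have := @window_has _ _ _ _ DE (size t).+1 4 T0 [:: T0; phi k T0; W] isT isT.
  rewrite [all _ _]/= cls_refl c3 c4 => /(_ _ isT) H.
  have {H} := H _; rewrite [map _ _]/=.
  rewrite (wbitsP eT0) (wbitsP eT0') (wbitsP eW) /desb /wdes /= fe fc -b2 ec (ltce nec) -(eqP ce) ec (ltce nec).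
  by move=> H; apply: fourth_letter_bits4 (H _); mlia.
have lt_c : (c < c') = (c < d) by rewrite -b2; move: ne ce; clear; lia.
apply: (addable_inj ac' ad) => g gu.
case: (eqVneq g c) => [->//|ngc].
case: (eqVneq g e) => [ge|nge]; first by rewrite ge in ngc gu *; rewrite (lt_e ngc gu).
(* In the first case [e] separates [g] from [d], so comparing [c'] with [e] suffices. This is
   possible by [lt_e] unless [c] is [e] or [e + 1], and then [lt_c] suffices. *)
have [triv|ntriv] := boolP ((g < e) == (e < d)).
  case: (eqVneq e c) => [ec|nec].
    by subst c; move: triv nge ce lt_c; clear; lia.
  case: (eqVneq c e.+1) => [ec|nc].
    by subst c; move: triv nge ngc ce ne lt_c; clear; lia.
  have eu : cnt e.+1 (rcons (rcons u e) c) < cnt e (rcons (rcons u e) c).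
    rewrite (cnt_rcons _ _ c) (negPf nc) addn0 cnt_rcons.
    have -> : (e == e.+1) = false by apply/negbTE; rewrite neq_ltn ltnSn.
    by rewrite addn0 !cnt_rcons eqxx addn1 (leq_ltn_trans (yam_cnt _ yu)) // ltn_addr.
  have := lt_e nec eu; move: triv nge ngc ce ne; clear; lia.
have gu' : cnt g.+1 (rcons u e) < cnt g (rcons u e).
  move: gu; rewrite !(cnt_rcons _ _ c) [c == g]eq_sym (negPf ngc) addn0.
  exact/leq_ltn_trans/leq_addr.
have eg : e != g by rewrite eq_sym.
have [t [T0]] := corner_lift eP eQ gu' eg; set h := (maxn e g).-1 => -[eT0 eT0'].
have st : size t + 5 = k.+1 by have := sizeP T0; rewrite eT0 size_cat.
pose T1 := phi (size t + 2) T0; pose Z := phi (size t + 2) (phi k T0); pose V := phi (size t + 3) Z.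
have ge : (g < e) = ~~ (e < d) by move: ntriv; clear; case: (g < e); case: (e < d).
have hg : (h < g) = (e < d) by rewrite /h; move: eg ge; clear; lia.
have he : (h < e) = ~~ (e < d) by rewrite /h; move: eg ge; clear; lia.
have eg' : (e < g) = (e < d) by move: eg ge; clear; lia.
have ec : (e < c) = ~~ (e < d) by rewrite pe negbK (eqP ce).
have gc : (g < c) = ~~ (e < d) by move: ngc ge ce ne eg; clear; lia.
have cg : (c < g) = (e < d) by move: ngc ge ce ne eg; clear; lia.
have swz x y : dd 2 [:: h; g; e; x; y] = [:: h; e; g; x; y].
  by rewrite /dd /= hg ge he; case: (e < d).
have eT1 : P T1 = t ++ [:: h; e; g; d; c] by rewrite (ddPw eT0) // swz.
have eZ : P Z = t ++ [:: h; e; g; c; c'] by rewrite (ddPw eT0') // swz.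
have eV : P V = t ++ [:: h; e; c; g; c'].
  by rewrite (ddPw eZ) // /dd /= eg' gc ec; case: (e < d).
have inw j U : size t + 2 <= j <= size t + 4 -> cls (size t).+2 ((size t).+1 + 5 - 2) U (phi j U).
  by move=> hj; apply: cls_phi; mlia.
have c1 : cls (size t).+2 ((size t).+1 + 5 - 2) T0 T1 by apply: inw; mlia.
have c3 : cls (size t).+2 ((size t).+1 + 5 - 2) T0 (phi k T0) by apply: inw; mlia.
have c4 : cls (size t).+2 ((size t).+1 + 5 - 2) T0 Z by apply: cls_trans c3 _; apply: inw; mlia.
have c5 : cls (size t).+2 ((size t).+1 + 5 - 2) T0 V by apply: cls_trans c4 _; apply: inw; mlia.
have := @window_has _ _ _ _ DE (size t).+1 5 T0 [:: T0; T1; phi k T0; Z; V] isT isT.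
rewrite [all _ _]/= cls_refl c1 c3 c4 c5 => /(_ _ isT) H.
have {H} := H _; rewrite [map _ _]/=.
have dc : (d < c) = ~~ (e < d) by rewrite pe negbK.
rewrite (wbitsP eT0) (wbitsP eT1) (wbitsP eT0') (wbitsP eZ) (wbitsP eV).
have -> : desb 5 (wdes [:: h; g; e; d; c]) = [:: e < d; ~~ (e < d); e < d; ~~ (e < d)].
  by rewrite /desb /wdes /= hg ge dc.
have -> : desb 5 (wdes [:: h; e; g; d; c]) = [:: ~~ (e < d); e < d; g < d; ~~ (e < d)].
  by rewrite /desb /wdes /= he eg' dc.
have -> : desb 5 (wdes [:: h; g; e; c; c']) = [:: e < d; ~~ (e < d); ~~ (e < d); e < d].
  by rewrite /desb /wdes /= hg ge ec -b2.
have -> : desb 5 (wdes [:: h; e; g; c; c']) = [:: ~~ (e < d); e < d; ~~ (e < d); e < d].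
  by rewrite /desb /wdes /= he eg' gc -b2.
have -> : desb 5 (wdes [:: h; e; c; g; c']) = [:: ~~ (e < d); ~~ (e < d); e < d; g < c'].
  by rewrite /desb /wdes /= he ec cg.
move=> H.
by apply: fourth_letter_bits5 (H _); mlia.
Qed.

Lemma swaplast T u e d c : P T = u ++ [:: e; d; c] -> swaps_last e d c ->
  P (phi k T) = u ++ [:: e; c; d].
Proof.
move=> eP sw; have [d' [c' eQ]] := phik_prefix eP sw.
have ed := swaplast_third eP sw eQ; rewrite ed in eQ.
by rewrite eQ (swaplast_fourth eP sw eQ).
Qed.

Lemma ddPk T : P (phi k T) = dd k (P T).
Proof.
have sz := sizeP T; have kz : 1 < k < size (P T) by rewrite sz ltnSn andbT; mlia.
have [u [x [y [z [t [eP su]]]]]] := split3 kz.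
have t0 : t = [::] by apply/eqP; rewrite -size_eq0; move: sz; rewrite eP size_cat /= su; mlia.
rewrite {}t0 in eP; rewrite [in RHS]eP dd_cat //.
case: eqP => [pq|/eqP ne].
  rewrite (phi_id DE k1) // desP ?desP; try mlia.
  rewrite eP /wdes !nth_cat su.
  have -> : (k < k - 2) = false by mlia.
  have -> : (k.-1 < k - 2) = false by mlia.
  have -> : (k.-1.-1 < k - 2) = false by mlia.
  have -> : k - (k - 2) = 2 by mlia.
  have -> : k.-1 - (k - 2) = 1 by mlia.
  by have -> : k.-1.-1 - (k - 2) = 0 by mlia.
case: ifP => s; first by have [-> _] := swapfirst eP ne s.
apply: swaplast eP _; rewrite /swaps_last ne; move: ne s; clear.
by case: (x < y); case: (y < z); case: (x < z).
Qed.

Lemma ddPle T i : 1 < i <= k -> P (phi i T) = dd i (P T).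
Proof.
case/andP=> i1; rewrite leq_eqVlt => /orP[/eqP->|ik]; first exact: ddPk.
by rewrite ddP ?i1.
Qed.

Lemma ddPwle t r T i : P T = t ++ r -> 1 < i < size r -> P (phi (size t + i) T) = t ++ dd i r.
Proof.
move=> eP hi; have sz := sizeP T; rewrite eP size_cat in sz.
by rewrite ddPle; [rewrite eP dd_shift //|]; mlia.
Qed.

(** * Injectivity of the covering *)

Lemma cls_perm T U : cls 2 k T U -> perm_eq (P T) (P U).
Proof.
apply: (cls_ind DE (P := fun U => perm_eq (P T) (P U))) => // j V j2 jn pV.
by rewrite (perm_trans pV) // ddPle // perm_sym perm_dd.
Qed.

Lemma cls_last T U : cls 2 k.-1 T U -> last 0 (P T) = last 0 (P U).
Proof.
apply: (cls_ind DE (P := fun U => last 0 (P T) = last 0 (P U))) => // j V j2 jn ->.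
have jk : 1 < j < k by mlia.
rewrite ddP //; have := sizeP V; case/lastP: (P V) => // r x; rewrite size_rcons => -[sr].
by rewrite dd_rcons ?sr // !last_rcons.
Qed.

Lemma clsk_sub T U : cls 2 k.-1 T U -> cls 2 k T U.
Proof. by apply: cls_sub => //; mlia. Qed.

Lemma realize T z : yam z -> perm_eq (P T) z -> last 0 (P T) = last 0 z ->
  exists2 S, cls 2 k.-1 T S & P S = z.
Proof.
have := sizeP T; case/lastP eP: (P T) => [|r x] //; rewrite size_rcons => -[sr] yz pz.
case/lastP: z yz pz => [|z y]; first by move=> _ /perm_size; rewrite size_rcons.
rewrite !last_rcons => yz pz exy; subst y; rewrite perm_rcons2 in pz.
have yz' : yam z by apply: (@yam_catl _ [:: x]); rewrite cats1.
rewrite -cats1 in eP; have sr' : size r <= k by rewrite sr.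
have [s hs es] := lift_word eP yz' pz sr'; exists (act s T); last by rewrite es cats1.
by apply: act_clsk; apply: all_lt_widen hs.
Qed.

(** By [injP], [U] is the element reached from [U1] by moves of the prefix, and these commute with
    [phi k]. *)
Lemma edge_same U1 U u1 u e d c : cls 2 k.-1 U1 U -> P U1 = u1 ++ [:: e; d; c] ->
  P U = u ++ [:: e; d; c] -> cls 2 k.-1 (phi k U1) (phi k U).
Proof.
move=> h e1 eU; have uk : size u1 + 2 = k by have := sizeP U1; rewrite e1 size_cat /=; mlia.
have yu : yam u by apply: (@yam_catl _ [:: e; d; c]); rewrite -eU.
have pu : perm_eq u1 u by have := cls_perm (clsk_sub h); rewrite e1 eU perm_cat2r.
have su : size u1 <= k by mlia.
have [s hs es] := lift_word e1 yu pu su.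
have <- : act s U1 = U.
  apply: injP; last by rewrite es eU.
  by apply: cls_trans h; rewrite cls_sym; apply: act_clsk; apply: all_lt_widen hs.
by rewrite -(act_phik _ uk hs); apply: act_clsk; apply: all_lt_widen hs.
Qed.

(* For [e1 <> e] the two edges commute with the Knuth move exchanging [e1] and [e], by uniqueness in degree 5. *)
Lemma edge_unique U1 U u1 e1 u e d c : cls 2 k.-1 U1 U -> P U1 = u1 ++ [:: e1; d; c] ->
  P U = u ++ [:: e; d; c] -> swaps_last e1 d c -> swaps_last e d c -> cls 2 k.-1 (phi k U1) (phi k U).
Proof.
move=> h eP1 eP sw1 sw; case: (eqVneq e1 e) => [ee|ne]; first by subst e1; apply: edge_same h eP1 eP.
have uk : size u1 + 2 = k by have := sizeP U1; rewrite eP1 size_cat /=; mlia.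
have y1 : yam (rcons u1 e1) by apply: (@yam_catl _ [:: d; c]); rewrite cat_rcons -eP1.
have y2 : yam (rcons u e) by apply: (@yam_catl _ [:: d; c]); rewrite cat_rcons -eP.
have pu : perm_eq (rcons u1 e1) (rcons u e).
  by have := cls_perm (clsk_sub h); rewrite eP1 eP -!(cat_rcons _ _ [:: d; c]) perm_cat2r.
have [t] := two_corners y1 y2 pu ne; set f := (maxn e1 e).-1 => /= -[ytfe _ pt].
have yt : yam (t ++ [:: f; e]) by apply: (@yam_catl _ [:: e1]); rewrite -catA.
have pt' : perm_eq u1 (t ++ [:: f; e]) by rewrite -(perm_rcons2 e1) (perm_trans pt) // -cats1 -catA.
have eQ1 := swaplast eP1 sw1.
have su : size u1 <= k by mlia.
have [s hs] := lift_word eP1 yt pt' su; rewrite -catA /=; set W1 := act s U1 => eW1.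
have c1 : cls 2 k.-1 U1 W1 by apply: act_clsk; apply: all_lt_widen hs.
have cp1 : cls 2 k.-1 (phi k U1) (phi k W1).
  by rewrite -(act_phik _ uk hs); apply: act_clsk; apply: all_lt_widen hs.
have st : size t + 5 = k.+1 by have := sizeP W1; rewrite eW1 size_cat.
have swp x y : dd 2 [:: f; e; e1; x; y] = [:: f; e1; e; x; y].
  rewrite /dd /=.
  have -> : (f < e) == (e < e1) = false by rewrite /f; move: ne; clear; lia.
  by have -> : (f < e1) == (f < e) = false by rewrite /f; move: ne; clear; lia.
pose W2 := phi (size t + 2) W1.
have eW2 : P W2 = t ++ [:: f; e1; e; d; c] by rewrite (ddPw eW1) // swp.
have c2 : cls 2 k.-1 W1 W2 by apply: cls_phi; mlia.
have eW2' : P W2 = (t ++ [:: f; e1]) ++ [:: e; d; c] by rewrite -catA.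
have eW1' : P W1 = (t ++ [:: f; e]) ++ [:: e1; d; c] by rewrite -catA.
have eV1 : P (phi k W1) = t ++ [:: f; e; e1; c; d] by rewrite (swaplast eW1' sw1) -catA.
have eV2 : P (phi k W2) = t ++ [:: f; e1; e; c; d] by rewrite (swaplast eW2' sw) -catA.
have eV3 : P (phi (size t + 2) (phi k W1)) = t ++ [:: f; e1; e; c; d] by rewrite (ddPw eV1) // swp.
have cV3 : cls 2 k.-1 (phi k W1) (phi (size t + 2) (phi k W1)) by apply: cls_phi; mlia.
have e32 : phi (size t + 2) (phi k W1) = phi k W2.
  apply: (wbits_inj DE (a := (size t).+1) (m := 5)) => //; first by mlia.
    rewrite cls_sym; apply: (@cls_trans _ _ _ _ _ _ W1); last first.
      by apply: (@cls_trans _ _ _ _ _ _ (phi k W1)); apply: cls_phi; mlia.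
    rewrite cls_sym; apply: (@cls_trans _ _ _ _ _ _ W2); apply: cls_phi; mlia.
  by rewrite (wbitsP eV3) (wbitsP eV2).
have c3 : cls 2 k.-1 W2 U.
  by apply: cls_trans h; rewrite cls_sym; apply: cls_trans c1 c2.
apply: cls_trans cp1 _; apply: cls_trans cV3 _; rewrite e32.
exact: edge_same c3 eW2' eP.
Qed.

(* A closed walk through words ending in [a], then [b], then [c]; it only uses comparisons of letters that
   do not depend on which of [a <= g <= h], [b <= f] are equalities. *)
Definition loop_words (h f c g b a : nat) : seq (seq nat) :=
  [:: [:: h; f; c; g; b; a]; [:: h; f; c; g; a; b]; [:: h; f; g; c; a; b]; [:: h; g; f; c; a; b];
      [:: h; g; f; a; c; b]; [:: h; g; a; f; c; b]; [:: h; g; a; f; b; c]; [:: h; g; f; a; b; c];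
      [:: h; f; g; a; b; c]; [:: h; f; g; b; a; c]; [:: h; f; g; b; c; a]; [:: h; g; f; b; c; a];
      [:: h; g; f; c; b; a]; [:: h; f; g; c; b; a]; [:: h; f; c; g; b; a]].
(** Indices are relative to the start of the six letters. Move 5 becomes [phi k]; it occurs at steps
    0, 5 and 9, where the last letter changes. *)
Definition loop_moves : seq nat := [:: 5; 3; 2; 4; 3; 5; 3; 2; 4; 5; 2; 4; 2; 3].

Lemma loop_dd h f c g b a j : a <= g <= h -> h < f < c -> g < b <= f -> j < 14 ->
  dd (nth 0 loop_moves j) (nth [::] (loop_words h f c g b a) j) = nth [::] (loop_words h f c g b a) j.+1.
Proof.
move=> h1 h2 h3.
have F : ((h < f) = true) * ((h < c) = true) * ((h < g) = false) * ((h < a) = false) * ((f < c) = true) * ((f < g) = false) *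
  ((f < b) = false) * ((f < a) = false) * ((c < g) = false) * ((c < b) = false) * ((c < a) = false) * ((c < f) = false) *
  ((g < b) = true) * ((g < a) = false) * ((g < f) = true) * ((g < c) = true) * ((b < a) = false) * ((b < c) = true) *
  ((a < b) = true) * ((a < f) = true) * ((a < c) = true) by do ![split]; move: h1 h2 h3; clear; lia.
by do 14?[case: j => [|j]; first by rewrite /dd /= !F].
Qed.

Definition loop_run (l : nat) (S : A) (j : nat) : A := act [seq l + i | i <- take j loop_moves] S.

Lemma loop_runS l S j : j < 14 ->
  loop_run l S j.+1 = phi (l + nth 0 loop_moves j) (loop_run l S j).
Proof.
by move=> j14; rewrite /loop_run (take_nth 0) // map_rcons act_rcons.
Qed.

Lemma loop_move_range j : j < 14 -> 1 < nth 0 loop_moves j < 6.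
Proof. by move=> h; have /allP := (isT : all (fun i => 1 < i < 6) loop_moves); apply; apply: mem_nth. Qed.

Section Loop.
Variables (v : seq nat) (h f c g b a : nat).
Hypotheses (h1 : a <= g <= h) (h2 : h < f < c) (h3 : g < b <= f).
Notation Z := (nth [::] (loop_words h f c g b a)).

Lemma size_loop_word j : j <= 14 -> size (Z j) = 6.
Proof. by do 15?[case: j => [|j] //]. Qed.

Lemma loop_run_word S j : P S = v ++ Z 0 -> j <= 14 -> P (loop_run (size v) S j) = v ++ Z j.
Proof.
move=> eS; elim: j => // j IH j14; rewrite loop_runS //.
have hj := IH (ltnW j14); rewrite (ddPwle hj) ?loop_dd //.
by rewrite size_loop_word ?loop_move_range // ltnW.
Qed.

(** All moves are involutions, so the walk can be traced back to its start from any of its words. *)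
Lemma loop_back S j : P S = v ++ Z j -> j <= 14 ->
  exists2 S0, P S0 = v ++ Z 0 & loop_run (size v) S0 j = S.
Proof.
elim: j S => [|j IH] S eS j14; first by exists S.
have sz := sizeP S; rewrite eS size_cat size_loop_word // in sz.
have rj := loop_move_range j14.
have eS' : P (phi (size v + nth 0 loop_moves j) S) = v ++ Z j.
  by rewrite (ddPwle eS) ?size_loop_word // -(loop_dd h1 h2 h3 j14) ddK.
have [S0 e0 eR] := IH _ eS' (ltnW j14); exists S0 => //.
rewrite loop_runS // eR (phiK DE) //; mlia.
Qed.

(** Both ends of the walk have the same word, whose six last letters have descent set {1,2,4}, and
    [wbits_inj6] admits no second element with it in the window class. *)
Lemma loop_closed S : P S = v ++ Z 0 -> loop_run (size v) S 14 = S.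
Proof.
move=> eS; have sz := sizeP S; rewrite eS size_cat /= in sz.
have eR := loop_run_word eS (leqnn 14).
have e : wbits Des (size v).+1 6 S = [:: true; true; false; true; false].
  rewrite (wbitsP eS) /desb /wdes /=.
  by do ![congr (_ :: _)]; move: h1 h2 h3; clear; lia.
apply/esym; apply: (wbits_inj6 DE (a := (size v).+1)) => //; first by mlia.
  apply: act_cls; rewrite all_map; apply/allP => i /mem_take /=.
  by rewrite !inE => hi; apply/andP; split; move: hi sz k1; clear; lia.
by rewrite (wbitsP eR) (wbitsP eS).
Qed.
End Loop.

(* A [phi k]-edge that changes the last letter from [x] to [y] joins the [k.-1]-classes of [T] and [U]. *)
Definition edge (T : A) (x y : nat) (U : A) : Prop := exists E u e,
  [/\ cls 2 k.-1 T E, P E = u ++ [:: e; y; x], swaps_last e y x & cls 2 k.-1 (phi k E) U].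

Lemma edge_sym T x y U : edge T x y U -> edge U y x T.
Proof.
case=> E [u [e [hT eE sw hU]]]; exists (phi k E), u, e; split.
- by rewrite cls_sym.
- exact: swaplast.
- by move: sw; rewrite /swaps_last; clear; lia.
- by rewrite (phiK DE) // cls_sym.
Qed.

(** The closed walk uses [phi k] once between each two of the three last letters and otherwise stays
    in a class under [phi 2, ..., phi k.-1]. As it closes up, the three classes met are joined
    pairwise. *)
Lemma triangle T a b c : a < b -> b < c ->
  cnt a.+1 (P T) < cnt a (P T) -> cnt b.+1 (P T) < cnt b (P T) -> cnt c.+1 (P T) < cnt c (P T) ->
  last 0 (P T) \in [:: a; b; c] ->
  exists rep : nat -> A, cls 2 k.-1 T (rep (last 0 (P T))) /\
    forall x y, x \in [:: a; b; c] -> y \in [:: a; b; c] -> x != y -> edge (rep x) x y (rep y).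
Proof.
move=> ab bc ca cb cc lT.
have [v [h [f [g [h1 h2 h3 yw pw]]]]] := six_corners (yamPP T) ab bc ca cb cc.
pose Z := nth [::] (loop_words h f c g b a).
have sz : size v + 5 = k by have := perm_size pw; rewrite sizeP size_cat /=; mlia.
have Zok j : j <= 14 -> yam (v ++ Z j) /\ perm_eq (P T) (v ++ Z j).
  elim: j => // j IH j14; have [y p] := IH (ltnW j14).
  have e : v ++ Z j.+1 = dd (size v + nth 0 loop_moves j) (v ++ Z j).
    by have /andP[r1 _] := loop_move_range j14; rewrite dd_shift // /Z loop_dd.
  have rj := loop_move_range j14.
  rewrite e; split; last by rewrite (perm_trans p) // perm_sym perm_dd.
  by apply: yam_dd => //; rewrite size_cat /Z size_loop_word ?(ltnW j14) //; mlia.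
(* A word of the walk with the last letter of [P T]: word 0 ends in [a], word 1 in [b], word 6 in
   [c]. *)
pose i0 := if last 0 (P T) == a then 0 else if last 0 (P T) == b then 1 else 6.
have i0P : i0 <= 14 by rewrite /i0; case: ifP => // _; case: ifP.
have li0 : last 0 (v ++ Z i0) = last 0 (P T).
  rewrite last_cat /i0; move: lT; rewrite !inE; case: eqP => [->//|_] /=; case: eqP => [->//|_] /= /eqP->.
  by [].
have [yi pi] := Zok _ i0P; have [S cS eS] := realize yi pi (esym li0).
have [S0 e0 eR] := loop_back h1 h2 h3 eS i0P.
pose R := loop_run (size v) S0.
have R0 : R 0 = S0 by [].
have R14 : R 14 = S0 by apply: (loop_closed h1 h2 h3).
have RP j : j <= 14 -> P (R j) = v ++ Z j by apply: loop_run_word.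
have Rs j : j < 14 -> nth 0 loop_moves j < 5 -> cls 2 k.-1 (R j) (R j.+1).
  move=> j14 m5; rewrite /R loop_runS //; have := loop_move_range j14 => rj.
  by apply: cls_phi; mlia.
have Rk j : j < 14 -> nth 0 loop_moves j = 5 -> R j.+1 = phi k (R j).
  by move=> j14 m5; rewrite /R loop_runS // m5 sz.
have c15 : cls 2 k.-1 (R 1) (R 5).
  by do 3![apply: (cls_trans (Rs _ _ _)) => //]; apply: Rs.
have c69 : cls 2 k.-1 (R 6) (R 9).
  by do 2![apply: (cls_trans (Rs _ _ _)) => //]; apply: Rs.
have cA : cls 2 k.-1 (R 10) (R 0).
  by rewrite R0 -R14; do 3![apply: (cls_trans (Rs _ _ _)) => //]; apply: Rs.
have Eab : edge (R 0) a b (R 1).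
  exists (R 0), (v ++ [:: h; f; c]), g; split; rewrite ?RP -?catA ?(Rk 0) ?cls_refl //.
  by move: h1 h2 h3; rewrite /swaps_last; clear; lia.
have Ebc : edge (R 1) b c (R 6).
  exists (R 5), (v ++ [:: h; g; a]), f; split; rewrite ?RP -?catA ?(Rk 5) ?cls_refl //.
  by move: h1 h2 h3; rewrite /swaps_last; clear; lia.
have Eca : edge (R 6) c a (R 0).
  exists (R 9), (v ++ [:: h; f; g]), b; split; rewrite ?RP -?catA -?(Rk 9) //.
  by move: h1 h2 h3; rewrite /swaps_last; clear; lia.
exists (fun x => if x == a then R 0 else if x == b then R 1 else R 6).
have nba : (b == a) = false by move: ab; clear; lia.
have nca : (c == a) = false by move: ab bc; clear; lia.
have ncb : (c == b) = false by move: ab bc; clear; lia.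
split.
  apply: (cls_trans cS); rewrite -eR -/(R i0) /i0.
  by case: ifP => _; [|case: ifP => _]; rewrite cls_refl.
move=> x y; rewrite !inE => /or3P[] /eqP-> /or3P[] /eqP->; rewrite ?eqxx ?nba ?nca ?ncb ?eqxx // => _.
- exact: edge_sym.
- exact: edge_sym.
- exact: edge_sym.
Qed.

(** Invariant for injectivity: at most one edge leads from the class of [T] to that of [U], and none
    if their last letters agree. *)
Definition near (T U : A) : Prop :=
  (last 0 (P U) = last 0 (P T) /\ cls 2 k.-1 T U) \/
  (last 0 (P U) != last 0 (P T) /\ edge T (last 0 (P T)) (last 0 (P U)) U).

Lemma edge_cls T x y U V : edge T x y U -> cls 2 k.-1 U V -> edge T x y V.
Proof.
by case=> E [u [e [h1 h2 h3 h4]]] h; exists E, u, e; split=> //; apply: cls_trans h4 h.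
Qed.

Lemma edge_cls_l T x y U V : edge T x y U -> cls 2 k.-1 V T -> edge V x y U.
Proof.
by case=> E [u [e [h1 h2 h3 h4]]] h; exists E, u, e; split=> //; apply: cls_trans h h1.
Qed.

Lemma edge_det T x y U V : edge T x y U -> edge T x y V -> cls 2 k.-1 U V.
Proof.
case=> E [u [e [h1 h2 h3 h4]]] [F [w [d [g1 g2 g3 g4]]]].
have EF : cls 2 k.-1 E F by apply: cls_trans g1; rewrite cls_sym.
have := edge_unique EF h2 g2 h3 g3 => h; rewrite cls_sym in h4.
exact: (cls_trans (cls_trans h4 h) g4).
Qed.

Lemma last_corner T : cnt (last 0 (P T)).+1 (P T) < cnt (last 0 (P T)) (P T).
Proof.
have := yamPP T; have := sizeP T; case/lastP: (P T) => // r x _ /rcons_corner; by rewrite last_rcons.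
Qed.

(** Only a [phi k] that exchanges the last two letters leaves the current class. If it restores the
    last letter of [T], uniqueness of edges leads back to the class of [T]; otherwise three last
    letters occur, and [triangle] replaces two edges by one. *)
Lemma near_closed T U j : cls 2 k T U -> 2 <= j <= k -> near T U -> near T (phi j U).
Proof.
move=> cTU jk nTU; case: (ltnP j k) => [ljk|gjk].
  have cj : cls 2 k.-1 U (phi j U) by apply: cls_phi; mlia.
  have l := cls_last cj; case: nTU => -[h1 h2]; [left|right]; rewrite -l; split=> //.
    exact: cls_trans h2 cj.
  exact: edge_cls h2 cj.
have -> : j = k by mlia.
have sz := sizeP U; have kz : 1 < k < size (P U) by rewrite sz ltnSn andbT; mlia.
have [u [e [d [c [t [eP su]]]]]] := split3 kz.
have t0 : t = [::] by apply/eqP; rewrite -size_eq0; move: sz; rewrite eP size_cat /= su; mlia.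
rewrite {}t0 {su} in eP.
have lU : last 0 (P U) = c by rewrite eP last_cat.
have bdes := wbitsP eP; rewrite /wbits /= in bdes; case: bdes => b1 b2.
have uk : size u + 2 = k by move: sz; rewrite eP size_cat /=; mlia.
case: (eqVneq (e < d) (d < c)) => [pq|ne].
  have -> // : phi k U = U.
  apply: (phi_id DE k1); have ek : k.-1 = (size u).+1 by mlia.
  have ek' : k = (size u).+2 by mlia.
  by rewrite ek [in RHS]ek' b1 b2 /wdes.
have [ce|nce] := boolP ((e < c) == (e < d)).
  have [eV cV] := swapfirst eP ne ce; have l := cls_last cV.
  case: nTU => -[h1 h2]; [left|right]; rewrite -l; split=> //.
    exact: cls_trans h2 cV.
  exact: edge_cls h2 cV.
have sw : swaps_last e d c.
  by rewrite /swaps_last ne; move: ne nce; clear; case: (e < d); case: (d < c); case: (e < c).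
have lV : last 0 (P (phi k U)) = d by rewrite (swaplast eP sw) last_cat.
have cd : d != c by move: sw; rewrite /swaps_last; clear; lia.
have EUV : edge U c d (phi k U) by exists U, u, e; split; rewrite ?cls_refl.
case: nTU => -[h1 h2].
  right; rewrite lV -h1 lU; split=> //.
  by apply: edge_cls_l EUV _.
rewrite lU in h1 h2; set a := last 0 (P T) in h1 h2 *.
have ETU := edge_sym h2.
case: (eqVneq d a) => [da|nda].
  left; rewrite lV; split=> //; rewrite da in EUV; exact: edge_det ETU EUV.
right; rewrite lV; split=> //.
have pTU := cnt_perm (cls_perm cTU).
have cka : cnt a.+1 (P T) < cnt a (P T) by apply: last_corner.
have ckc : cnt c.+1 (P T) < cnt c (P T) by rewrite !pTU -lU; apply: last_corner.
have ckd : cnt d.+1 (P T) < cnt d (P T).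
  have cUV : cls 2 k U (phi k U) by apply: cls_phi; mlia.
  by rewrite !pTU !(cnt_perm (cls_perm cUV)) -lV; apply: last_corner.
have fin rep x y z : a \in [:: x; y; z] -> c \in [:: x; y; z] -> d \in [:: x; y; z] ->
    cls 2 k.-1 T (rep a) -> (forall p q, p \in [:: x; y; z] -> q \in [:: x; y; z] -> p != q ->
      edge (rep p) p q (rep q)) -> edge T a d (phi k U).
  move=> ia ic id cr hr.
  have nac : a != c by rewrite eq_sym.
  have nad : a != d by rewrite eq_sym.
  have ncd : c != d by rewrite eq_sym.
  have c1 : cls 2 k.-1 U (rep c).
    by apply: edge_det h2 _; apply: edge_cls_l (hr _ _ ia ic nac) cr.
  have c2 : cls 2 k.-1 (rep d) (phi k U).
    by apply: edge_det (edge_cls_l (hr _ _ ic id ncd) c1) EUV.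
  by apply: edge_cls c2; apply: edge_cls_l (hr _ _ ia id nad) cr.
(* [triangle] wants its corners in increasing order, while [a], [c], [d] may come in any order. *)
have go x y z : x < y -> y < z -> (forall w, w \in [:: a; c; d] = (w \in [:: x; y; z])) -> edge T a d (phi k U).
  move=> xy yz hw.
  have ck w : w \in [:: x; y; z] -> cnt w.+1 (P T) < cnt w (P T).
    by rewrite -hw !inE => /or3P[] /eqP->.
  have [||||rep [r1 r2]] := @triangle T x y z xy yz; rewrite ?ck ?inE ?eqxx ?orbT //.
    by have := hw a; rewrite !inE eqxx => <-.
  by apply: (fin rep x y z) => //; rewrite -hw !inE eqxx ?orbT.
have nac : (a < c) || (c < a) by rewrite -neq_ltn eq_sym.
have nad : (a < d) || (d < a) by rewrite -neq_ltn eq_sym.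
have ncd : (c < d) || (d < c) by rewrite -neq_ltn eq_sym.
case/orP: nac => x1; case/orP: nad => x2; case/orP: ncd => x3.
- by apply: (go a c d) => // w.
- by apply: (go a d c) => // w; rewrite !inE; do !case: eqP.
- by move: x1 x2 x3; clear; lia.
- by apply: (go d a c) => // w; rewrite !inE; do !case: eqP.
- by apply: (go c a d) => // w; rewrite !inE; do !case: eqP.
- by move: x1 x2 x3; clear; lia.
- by apply: (go c d a) => // w; rewrite !inE; do !case: eqP.
- by apply: (go d c a) => // w; rewrite !inE; do !case: eqP.
Qed.

Lemma injPk T U : cls 2 k T U -> P T = P U -> T = U.
Proof.
move=> cTU ePP.
have [cU nU] : cls 2 k T U /\ near T U.
  apply: (cls_ind DE (P := fun U => cls 2 k T U /\ near T U) _ _ _ cTU) => //.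
    move=> j V j2 jn [cV nV]; split; last exact: near_closed.
    by apply: cls_trans cV _; apply: cls_phi.
  by split; [exact: cls_refl | left; split; rewrite ?cls_refl].
case: nU => -[h1 h2]; first exact: injP.
by rewrite ePP eqxx in h1.
Qed.
End Step.

(** * Induction on the degree *)

(** State of the induction, with the first [k] letters known. The last clause ranges over all [j],
    including those for which [phi j] is not yet known to act as [dd j]; the treatment of the next
    involution starts from it. *)
Definition labelling (A : finType) (n : nat) (Des : A -> pred nat) (phi : nat -> A -> A)
    (k : nat) (P : A -> seq nat) : Prop :=
  [/\ forall T, size (P T) = k /\ yam (P T),
      forall T i, 0 < i < k -> Des T i = wdes (P T) i,
      forall T i, 1 < i < k -> P (phi i T) = dd i (P T),
      forall T U, in_class n phi 2 k.-1 T U -> P T = P U -> T = U &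
      forall T j, 1 < j < n -> take (j - 2) (P (phi j T)) = take (j - 2) (P T)].

Section Extend.
Variables (A : finType) (n : nat) (Des : A -> pred nat) (phi : nat -> A -> A).
Hypothesis Des_range : forall T d, Des T d -> 0 < d < n.
Hypothesis DE : is_dual_equivalence n Des phi.
Notation cls := (@in_class A n phi).
Notation act := (act phi).
Variables (k : nat) (P : A -> seq nat).
Hypothesis kn : k < n.
Hypothesis LP : labelling n Des phi k P.

Let sizeP T : size (P T) = k. Proof. by case: LP => h _ _ _ _; have [] := h T. Qed.
Let yamPP T : yam (P T). Proof. by case: LP => h _ _ _ _; have [] := h T. Qed.
Let desP T i : 0 < i < k -> Des T i = wdes (P T) i.
Proof. by case: LP => _ h _ _ _; apply: h. Qed.
Let ddP T i : 1 < i < k -> P (phi i T) = dd i (P T).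
Proof. by case: LP => _ _ h _ _; apply: h. Qed.
Let injP T U : cls 2 k.-1 T U -> P T = P U -> T = U.
Proof. by case: LP => _ _ _ h _; apply: h. Qed.
Let takeP T j : 1 < j < n -> take (j - 2) (P (phi j T)) = take (j - 2) (P T).
Proof. by case: LP => _ _ _ _ h; apply: h. Qed.

Let act_cls' s T : all (fun i => 1 < i < k) s -> cls 2 k.-1 T (act s T).
Proof. by move=> hs; apply: act_cls; apply: sub_all hs => i; move: kn; clear; lia. Qed.

Let clsP T U : cls 2 k.-1 T U -> perm_eq (P T) (P U).
Proof.
apply: (cls_ind DE (P := fun U => perm_eq (P T) (P U))) => // j V j2 jn pV.
rewrite (perm_trans pV) // ddP; first by rewrite perm_sym perm_dd.
by move: j2; clear; lia.
Qed.

Lemma cls_path T U : cls 2 k.-1 T U -> exists2 s, all (fun i => 1 < i < k) s & act s T = U.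
Proof.
apply: (cls_ind DE (P := fun U => exists2 s, all (fun i => 1 < i < k) s & act s T = U)) => //.
  move=> j V j2 jn [s hs es]; exists (rcons s j); last by rewrite act_rcons es.
  by rewrite all_rcons hs andbT; move: j2; clear; lia.
by exists [::].
Qed.

(** Elements of the class with equal last letters are joined by moves [phi i] with [i + 2 <= k],
    which keep the descent at [k] by [far_r]. *)
Lemma des_last U V : cls 2 k.-1 U V -> last 0 (P U) = last 0 (P V) -> 0 < k -> Des U k = Des V k.
Proof.
move=> cUV; have := sizeP U; have := sizeP V; have yU := yamPP U; have yV := yamPP V; have pUV := clsP cUV.
case/lastP eU: (P U) yU pUV => [|u g]; first by move=> _ _ _ <-.
case/lastP eV: (P V) yV => [|v g'] yV yU; first by move=> _ <-.
rewrite !last_rcons => puv; rewrite !size_rcons => sv su e _; subst g'.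
move: yU yV; rewrite !yam_rcons perm_rcons2 in puv * => /andP[yu _] /andP[yv _].
have [s hs es] := yam_connected yu yv puv.
have hsk : all (fun i => 1 < i < k) s by apply: all_lt_widen hs; rewrite -su.
have eS : act s U = V.
  apply: injP; first by apply: cls_trans cUV; rewrite cls_sym; apply: act_cls'.
  by rewrite (act_dact ddP) // eU dact_rcons // es eV.
rewrite -eS; have : all (fun i => 1 < i < k.-1) s by apply: all_lt_widen hs; rewrite -su.
elim: (s) (U) => //= i t IH W /andP[hi ht]; rewrite -(IH _ ht) (far_r Des_range DE) //.
  by move: hi kn; clear; lia.
by move: hi kn; clear; lia.
Qed.

(** By [des_last] the two words may be taken as [t f g' g] and [t f g g']. In their window of degree
    4 the descent sets {1} and {2,3} do not occur in one shape. *)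
Lemma des_mono U V : cls 2 k.-1 U V -> 0 < k -> last 0 (P U) < last 0 (P V) -> Des V k -> Des U k.
Proof.
move=> cUV k0; have sU := sizeP U; have sV := sizeP V; have yU := yamPP U; have yV := yamPP V; have pUV := clsP cUV.
case/lastP eU: (P U) yU pUV sU => [|u g] yU pUV sU; first by move: k0; rewrite -sU.
case/lastP eV: (P V) yV pUV sV => [|v g'] yV pUV sV; first by move: k0; rewrite -sV.
rewrite !last_rcons => lt dV.
have ne : g != g' by move: lt; clear; lia.
have [t] := two_corners yU yV pUV ne; set f := (maxn g g').-1 => /= -[y1 y2 p1].
have [s hs es] := yam_connected yU y1 p1; rewrite sU in hs.
pose U1 := act s U; have cU1 : cls 2 k.-1 U U1 by apply: act_cls'.
have eU1 : P U1 = t ++ [:: f; g'; g] by rewrite (act_dact ddP) // eU es.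
have st : size t + 3 = k by rewrite -(sizeP U1) eU1 size_cat.
have r2 : 1 < size t + 2 < k by rewrite -st; clear; lia.
pose V1 := phi (size t + 2) U1.
have cV1 : cls 2 k.-1 U1 V1 by apply: cls_phi; move: r2 kn; clear; lia.
have eV1 : P V1 = t ++ [:: f; g; g'].
  rewrite ddP // eU1 dd_shift // /dd /=.
  have -> : (f < g') == (g' < g) = false by rewrite /f; move: lt; clear; lia.
  by have -> : (f < g) == (f < g') = false by rewrite /f; move: lt; clear; lia.
have dU : Des U k = Des U1 k by apply: des_last => //; rewrite eU eU1 last_rcons last_cat.
have dV1 : Des V1 k.
  rewrite -(des_last (U := V)) //; last by rewrite eV eV1 last_rcons last_cat.
  by apply: cls_trans _ cV1; apply: cls_trans _ cU1; rewrite cls_sym.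
rewrite dU; apply: contraT => ndU.
have c4 : cls (size t).+2 ((size t).+1 + 4 - 2) U1 V1 by apply: cls_phi; move: r2 kn; clear; lia.
have := @window_has _ _ _ _ DE (size t).+1 4 U1 [:: U1; V1] isT isT.
rewrite [all _ _]/= cls_refl c4 => /(_ _ isT) H; have {H} := H _.
have d3 W x y z : P W = t ++ [:: x; y; z] -> wbits Des (size t).+1 4 W = [:: x < y; y < z; Des W k].
  move=> eW; rewrite /wbits /=; have e3 : (size t).+3 = k by move: st; clear; lia.
  rewrite e3 (desP W (i := (size t).+1)) ?(desP W (i := (size t).+2)) ?eW; try by move: e3; clear; lia.
  rewrite /wdes !nth_cat /=.
  have -> : (size t).+1 < size t = false by clear; lia.
  have -> : (size t).+2 < size t = false by clear; lia.
  by rewrite ltnn subnn subSnn subSn ?leqnSn // subSnn.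
rewrite [map _ _]/= (d3 _ _ _ _ eU1) (d3 _ _ _ _ eV1) dV1 (negPf ndU).
have -> : (f < g') = true by rewrite /f; move: lt; clear; lia.
have -> : (g' < g) = false by move: lt; clear; lia.
have -> : (f < g) = false by rewrite /f; move: lt; clear; lia.
rewrite lt => H; have : has (fun L => all (mem L) [:: [:: true; false; false]; [:: false; true; true]]) (deslists 4).
  by apply: H; move: st kn; clear; lia.
by vm_compute.
Qed.

(** The row for the entry [k + 1]: a descent at [k] must mean that the entry [k] lies in a higher
    row. *)
Definition next_row_spec (T : A) (c : nat) : bool :=
  addable (P T) c && [forall U, cls 2 k.-1 T U ==> (Des U k == (last 0 (P U) < c))].

(* The new row is just below the lowest row from which the entry [k] produces a descent. *)
Lemma next_row_spec_ex T : exists c, next_row_spec T c.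
Proof.
have [/existsP[U0 U0P]|/existsPn h] := boolP [exists U, cls 2 k.-1 T U && Des U k]; last first.
  exists 0; apply/andP; split; first by rewrite /addable eqxx.
  apply/forallP => U; apply/implyP => cU; have := h U; rewrite cU /= ltn0.
  by move/negPf->.
have k0 : 0 < k by case/andP: U0P => _ /Des_range /andP[].
case: (@arg_maxnP A U0 (fun U => cls 2 k.-1 T U && Des U k) (fun U => last 0 (P U)) U0P) => U /andP[cU dU] Umax.
exists (last 0 (P U)).+1; apply/andP; split.
  rewrite /addable /= !(cnt_perm (clsP cU)); have := yamPP U; have := sizeP U.
  case/lastP: (P U) => [e|r x _ /rcons_corner]; first by move: k0; rewrite -e.
  by rewrite last_rcons.
apply/forallP => V; apply/implyP => cV; rewrite ltnS; apply/eqP.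
have cVU : cls 2 k.-1 V U by apply: cls_trans cU; rewrite cls_sym.
apply/idP/idP => [dV|]; first by apply: Umax; rewrite cV.
rewrite leq_eqVlt => /orP[/eqP e|lt]; first by rewrite (des_last cVU).
exact: des_mono dU.
Qed.

(** Every corner is the last letter of some element of the class, so the descents at [k] tell which
    corners lie above the new row. *)
Lemma next_row_spec_uniq T c c' : next_row_spec T c -> addable (P T) c' ->
  (forall U, cls 2 k.-1 T U -> Des U k = (last 0 (P U) < c')) -> c = c'.
Proof.
case/andP=> ac /forallP h ac' h'; apply: (addable_inj ac ac') => g gT.
have [v yv vT] := corner_yam (yam_partc (yamPP T)) gT.
have vT' : perm_eq (P T) (rcons v g) by rewrite perm_sym.
have [s hs es] := yam_connected (yamPP T) yv vT'; rewrite sizeP in hs.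
have cS := act_cls' T hs.
have := h (act s T); rewrite cS /= => /eqP h1; have := h' _ cS.
by rewrite h1 (act_dact ddP) // es last_rcons.
Qed.

Definition next_row (T : A) : nat := xchoose (next_row_spec_ex T).
Definition extend (T : A) : seq nat := rcons (P T) (next_row T).

Let nextP T : next_row_spec T (next_row T). Proof. exact: xchooseP. Qed.

Let next_addable T : addable (P T) (next_row T). Proof. by case/andP: (nextP T). Qed.

Let next_des T U : cls 2 k.-1 T U -> Des U k = (last 0 (P U) < next_row T).
Proof. by move=> cU; case/andP: (nextP T) => _ /forallP/(_ U); rewrite cU => /eqP. Qed.

Let next_cls T U : cls 2 k.-1 T U -> next_row T = next_row U.
Proof.
move=> cU; apply: (next_row_spec_uniq (nextP T)); first by rewrite (addable_perm _ (clsP cU)).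
by move=> V cV; apply: next_des; apply: cls_trans cV; rewrite cls_sym.
Qed.

(** [phi j] commutes with the moves of the class and keeps the descent at [k] by [far_l], so the
    specification of the row is unchanged. *)
Let next_far T j : 1 < j < n -> k + 3 <= j -> next_row (phi j T) = next_row T.
Proof.
move=> j1 kj; have eP W : P (phi j W) = P W.
  by have := takeP W j1; rewrite !take_oversize ?sizeP //; move: kj; clear; lia.
apply: (next_row_spec_uniq (nextP _)); rewrite ?eP // => U /cls_path[s hs <-].
have -> : act s (phi j T) = phi j (act s T).
  apply: (act_phi DE) => //; apply: sub_all hs => i; move: kj kn; clear; lia.
rewrite (far_l Des_range DE) // eP; exact/next_des/act_cls'.
Qed.

Lemma extendP : labelling n Des phi k.+1 extend.
Proof.
have sz T : size (extend T) = k.+1 by rewrite size_rcons sizeP.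
have ym T : yam (extend T) by rewrite yam_rcons yamPP next_addable.
have ds T i : 0 < i <= k -> Des T i = wdes (extend T) i.
  move=> ik; rewrite /wdes /extend !nth_rcons sizeP.
  have -> : i.-1 < k by move: ik; clear; lia.
  case: (ltnP i k) => ik'; first by rewrite desP //; move: ik ik'; clear; lia.
  have -> : i = k by move: ik ik'; clear; lia.
  by rewrite eqxx (next_des (cls_refl _ _ _ _ T)) -(sizeP T) nth_last.
have dd' T i : 1 < i < k -> extend (phi i T) = dd i (extend T).
  move=> ik; rewrite /extend dd_rcons ?sizeP // ddP //; congr rcons; apply/esym/next_cls.
  by apply: cls_phi; move: ik kn; clear; lia.
have ij T U : cls 2 k.-1 T U -> extend T = extend U -> T = U.
  by move=> cU /rcons_inj[e _]; apply: injP.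
have tk T j : 1 < j < n -> take (j - 2) (extend (phi j T)) = take (j - 2) (extend T).
  move=> j1; rewrite /extend -!cats1; case: (leqP (j - 2) k) => jk.
    by rewrite !takel_cat ?sizeP // takeP.
  have kj : k + 3 <= j by move: jk; clear; lia.
  rewrite (next_far T j1 kj); have -> // : P (phi j T) = P T.
  by have := takeP T j1; rewrite !take_oversize ?sizeP // ltnW.
(* For [k <= 1] no index satisfies [1 < i <= k], and the classes are singletons. *)
case: (ltnP 1 k) => k1; last first.
  split=> //; first by move=> T i; move: k1; clear; lia.
  move=> T U cU _; move: cU; apply: (cls_ind DE (P := fun U => T = U)) => //.
  by move=> j V; move: k1; clear; lia.
have k1n : 1 < k < n by rewrite k1.
split=> //.
  move=> T i /andP[i1]; rewrite ltnS leq_eqVlt => /orP[/eqP->|ik].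
    exact: (ddPk Des_range DE k1n sz ym ds dd' tk).
  by apply: dd'; rewrite i1.
exact: (injPk Des_range DE k1n sz ym ds dd' ij tk).
Qed.
End Extend.

Lemma labelling_ex (A : finType) (n : nat) (Des : A -> pred nat) (phi : nat -> A -> A) :
  (forall T d, Des T d -> 0 < d < n) -> is_dual_equivalence n Des phi ->
  exists P, labelling n Des phi n P.
Proof.
move=> Des_range DE.
suff H k : k <= n -> exists P, labelling n Des phi k P by apply: H.
elim: k => [_|k IH kn]; last first.
  have [P LP] := IH (ltnW kn); exists (extend Des_range DE kn LP).
  exact: extendP.
exists (fun=> [::]); split=> //; try by move=> T i; rewrite ltn0 andbF.
move=> T U cU _; move: cU; apply: (cls_ind DE (P := fun U => T = U)) => //.
by move=> j V; clear; lia.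
Qed.

(** * Dominance *)

Definition despos (n : nat) (D : pred nat) : seq nat := [seq d <- iota 1 n.-1 | D d].

Lemma sumn_diff n x s j : path leq x s -> all (fun y => y <= n) (x :: s) ->
  x + sumn (take j [seq p.2 - p.1 | p <- zip (x :: s) (rcons s n)]) = nth n (x :: s) j.
Proof.
elim: s x j => [|y s IH] x j /=.
  by move=> _ /andP[xn _]; case: j => [|[|j]] /=; rewrite ?addn0 ?subnKC ?nth_nil.
case/andP=> xy ps /andP[xn al]; case: j => [|j] /=; first by rewrite addn0.
by rewrite addnA subnKC // IH.
Qed.

(** The partial sums are 0, the descents in order, then [n]; the default [n] of [nth] supplies the
    last sum and all later ones. *)
Lemma sumn_take_comp n D j : sumn (take j (comp_of_des n D)) = nth n (0 :: despos n D) j.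
Proof.
have al : all (fun y => y <= n) (0 :: despos n D).
  by apply/allP => y; rewrite inE mem_filter mem_iota; clear; lia.
have pt : path leq 0 (despos n D).
  have := sorted_filter leq_trans D (iota_sorted 1 n.-1); rewrite -/(despos n D).
  by case: (despos n D).
by rewrite -(sumn_diff j pt al) add0n.
Qed.

Lemma size_comp n D : size (comp_of_des n D) = (size (despos n D)).+1.
Proof. by rewrite size_map size_zip size_rcons /= minnn. Qed.

Lemma dominatesP n D E : reflect (forall j, nth n (0 :: despos n E) j <= nth n (0 :: despos n D) j)
  (dominates (comp_of_des n D) (comp_of_des n E)).
Proof.
apply: (iffP allP) => h j; last by rewrite !sumn_take_comp.
have := h j; rewrite mem_iota !sumn_take_comp !size_comp add0n ltnS.
case: (leqP j (maxn (size (despos n D)).+1 (size (despos n E)).+1)) => [_|lt _]; first exact.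
by rewrite !nth_default //= ; move: lt; clear; lia.
Qed.

Definition ndes (D : pred nat) (i : nat) : nat := count D (iota 1 i).

Lemma ndesS D i : ndes D i.+1 = ndes D i + D i.+1.
Proof. by rewrite /ndes -{1}(addn1 i) iotaD count_cat /= addn0 add1n. Qed.

Lemma ndes_le D i j : i <= j -> ndes D i <= ndes D j.
Proof. by move=> ij; rewrite /ndes -(subnKC ij) iotaD count_cat leq_addr. Qed.

(** Dominance speaks of the place of the [j]-th descent, letters of words of the number of descents
    up to a place; this links the two. *)
Lemma ndes_despos n D i j : i < n -> (ndes D i < j) = (i < nth n (0 :: despos n D) j).
Proof.
case: j => [|j] ilt /=; first by rewrite ltn0.
have -> : ndes D i = count (fun y => y < i.+1) (despos n D).
  rewrite /despos count_filter /ndes.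
  have -> : n.-1 = i + (n.-1 - i) by lia.
  rewrite iotaD count_cat [X in _ + X](_ : _ = 0) ?addn0.
    apply: eq_in_count => y; rewrite mem_iota => hy /=.
    by have -> : y < i.+1 by lia.
  apply/eqP; rewrite -leqn0 leqNgt -has_count; apply/hasPn => y; rewrite mem_iota => hy /=.
  by have -> : y < i.+1 = false by lia.
have ss : sorted leq (despos n D) by have := sorted_filter leq_trans D (iota_sorted 1 n.-1).
case: (ltnP j (size (despos n D))) => js.
  have := sorted_count i.+1 ss js; rewrite (set_nth_default n 0 js) !ltnS => e.
  by rewrite leqNgt -e -ltnNge.
by rewrite nth_default // ilt ltnS (leq_trans (count_size _ _)).
Qed.

(** At an ascent to [x + 1], the letter [x] has occurred earlier, with at least [x] ascents up to
    it, and the new ascent adds one. *)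
Lemma yam_le_ndes v i : yam v -> i < size v -> nth 0 v i <= ndes (wdes v) i.
Proof.
move=> yv; elim/ltn_ind: i => i IH iv; case: i IH iv => [|i] IH iv.
  have /allP/(_ 0) := yv; rewrite mem_iota add0n iv take0 /addable /= => /(_ isT).
  by case/orP=> [/eqP->//|]; rewrite cnt_nil ltn0.
rewrite ndesS /wdes /=; case: (ltnP (nth 0 v i) (nth 0 v i.+1)) => [lt|le].
  have /allP/(_ i.+1) := yv; rewrite mem_iota add0n iv /addable /= => /(_ isT).
  case/orP=> [/eqP->//|]; case ex: (nth 0 v i.+1) lt => [|x] // _ /=.
  move=> h; have : 0 < cnt x (take i.+1 v) by apply: leq_ltn_trans h.
  rewrite cnt_gt0 => /(nthP 0)[i' i'1 e]; rewrite size_takel ?(ltnW iv) // in i'1.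
  rewrite nth_take // in e; rewrite addn1 ltnS -e.
  by apply: leq_trans (IH i' i'1 (ltn_trans i'1 iv)) _; apply: ndes_le.
by rewrite addn0 (leq_trans le) // IH // ltnW.
Qed.

Lemma sorted_ndes z i : sorted leq z -> i < size z -> ndes (wdes z) i <= nth 0 z i.
Proof.
move=> sz; elim: i => // i IH iz; rewrite ndesS /wdes /=.
have h := IH (ltnW iz); have /(sortedP 0)/(_ i iz) le := sz.
by case: ltnP => [lt|_]; rewrite ?addn1 ?addn0; [apply: leq_ltn_trans h lt | apply: leq_trans h le].
Qed.

Lemma yam_sort w : partc w -> yam (sort leq w).
Proof.
move=> pw; apply/yamP => k j; set z := sort leq w.
have sz : sorted leq z by apply: sort_sorted leq_total _.
case: (posnP (cnt j.+1 (take k z))) => [->//|]; rewrite cnt_gt0 => jin.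
have cz i : cnt i z = cnt i w by apply: cnt_perm; rewrite perm_sort.
have : cnt j.+1 z <= cnt j z by rewrite !cz; apply: pw.
rewrite -{1 2}(cat_take_drop k z) !cnt_cat.
have -> : cnt j (drop k z) = 0.
  apply/eqP; rewrite -leqn0 leqNgt cnt_gt0; apply/negP => jd.
  move: sz; rewrite -(cat_take_drop k z) (sorted_pairwise leq_trans) pairwise_cat => /and3P[/allrelP h _ _].
  by have := h _ _ jin jd; rewrite ltnn.
by rewrite addn0; apply: leq_trans; apply: leq_addr.
Qed.

Lemma count_lt_iota n S : S <= n -> count (fun i => i < S) (iota 0 n) = S.
Proof.
move=> Sn; rewrite -(subnKC Sn) iotaD count_cat [X in _ + X](_ : _ = 0) ?addn0.
  by rewrite -[RHS](size_iota 0); apply/eqP; rewrite -all_count; apply/allP => i; rewrite mem_iota.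
by apply/eqP; rewrite -leqn0 leqNgt -has_count; apply/hasPn => y; rewrite mem_iota -leqNgt => /andP[].
Qed.

Lemma count_nth_iota (a : pred nat) v : count a v = count (fun i => a (nth 0 v i)) (iota 0 (size v)).
Proof. by rewrite -{1}(mkseq_nth 0 v) count_map. Qed.

Lemma nth_despos_le n D j : nth n (0 :: despos n D) j <= n.
Proof.
case: (ltnP j (size (0 :: despos n D))) => h; last by rewrite nth_default.
have := mem_nth n h; rewrite inE => /orP[/eqP->//|].
by rewrite mem_filter mem_iota => /andP[_]; move: (nth _ _ _) => y; clear; lia.
Qed.

(** By [yam_le_ndes], positions before the [j]-th partial sum carry letters below [j]. For
    increasing words [sorted_despos] gives equality. *)
Lemma yam_despos v j : yam v -> nth (size v) (0 :: despos (size v) (wdes v)) j <= count (fun x => x < j) v.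
Proof.
move=> yv; rewrite -[leqLHS](count_lt_iota (nth_despos_le _ _ _)) (count_nth_iota _ v).
rewrite -!size_filter; apply: uniq_leq_size; first by rewrite filter_uniq ?iota_uniq.
move=> i; rewrite !mem_filter => /andP[h]; rewrite mem_iota add0n => iv; rewrite iv andbT.
by apply: leq_ltn_trans (yam_le_ndes yv iv) _; rewrite (ndes_despos _ _ iv).
Qed.

Lemma sorted_despos z j : yam z -> sorted leq z ->
  nth (size z) (0 :: despos (size z) (wdes z)) j = count (fun x => x < j) z.
Proof.
move=> yz sz; rewrite -[LHS](count_lt_iota (nth_despos_le _ _ _)) (count_nth_iota _ z).
apply: eq_in_count => i; rewrite mem_iota add0n => iz; rewrite -ndes_despos //.
by congr (_ < _); apply/eqP; rewrite eqn_leq sorted_ndes // yam_le_ndes.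
Qed.

Lemma sum_le_eq (v z : seq nat) : size v = size z -> sumn v = sumn z ->
  (forall i, nth 0 v i <= nth 0 z i) -> v = z.
Proof.
elim: v z => [|x v IH] [|y z] //= [sv] e h.
have le : sumn v <= sumn z.
  have {}h i : nth 0 v i <= nth 0 z i by apply: (h i.+1).
  elim: (v) (z) sv h {e IH} => [|a p IHp] [|b q] //= [spq] h.
  by have := h 0; have := IHp q spq (fun i => h i.+1); rewrite /=; clear; lia.
have xy : x <= y by apply: (h 0).
have ex : x = y by move: e le xy; clear; lia.
rewrite ex; congr (_ :: _); apply: IH => //; first by move: e; rewrite ex; clear; lia.
by move=> i; apply: (h i.+1).
Qed.

Lemma sumn_perm (v z : seq nat) : perm_eq v z -> sumn v = sumn z.
Proof. by move=> p; rewrite !sumnE; apply: perm_big. Qed.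

Lemma dominates_sorted v z : yam v -> yam z -> sorted leq z -> perm_eq v z ->
  dominates (comp_of_des (size z) (wdes z)) (comp_of_des (size z) (wdes v)).
Proof.
move=> yv yz sz pvz; have e := perm_size pvz; apply/dominatesP => j.
rewrite sorted_despos // -(permP pvz) -e; exact: yam_despos.
Qed.

(** Dominance bounds the letters of [v] by those of [z] place by place, and the two words have the
    same sum. *)
Lemma dominates_eq v z : yam v -> yam z -> sorted leq z -> perm_eq v z ->
  dominates (comp_of_des (size z) (wdes v)) (comp_of_des (size z) (wdes z)) -> v = z.
Proof.
move=> yv yz sz pvz /dominatesP h; have e := perm_size pvz.
apply: sum_le_eq => // [|i]; first exact: sumn_perm.
case: (ltnP i (size v)) => iv; last by rewrite nth_default.
apply: leq_trans (yam_le_ndes yv iv) _; rewrite e in iv.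
apply: leq_trans _ (sorted_ndes _ iv); last by [].
rewrite -ltnS (ndes_despos _ _ iv); apply: leq_trans (h _).
by rewrite -ndes_despos.
Qed.

Lemma comp_sorted z : yam z -> sorted leq z ->
  let la := comp_of_des (size z) (wdes z) in
  is_partition (size z) la /\ forall j, nth 0 la j = cnt j z.
Proof.
move=> yz sz la.
have st j : sumn (take j la) = count (fun x => x < j) z by rewrite sumn_take_comp sorted_despos.
have nl j : nth 0 la j = cnt j z.
  have : count (fun x => x < j.+1) z = count (fun x => x < j) z + cnt j z.
    rewrite /cnt -count_predUI -[LHS]addn0; congr (_ + _).
      by apply: eq_count => x /=; rewrite ltnS leq_eqVlt orbC.
    by rewrite -(count_pred0 z); apply: eq_count => x /=; case: ltngtP.
  rewrite -!st; case: (ltnP j (size la)) => jl.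
    by rewrite (take_nth 0 jl) -cats1 sumn_cat /= addn0; clear; lia.
  by rewrite nth_default // !take_oversize ?(leq_trans jl) //; clear; lia.
split=> //; apply/andP; split.
  apply/(sortedP 0) => i il; rewrite !nl; exact: yam_cnt.
have := st (size la); rewrite take_size => ->.
have := sumn_take_comp (size z) (wdes z) (size la); rewrite -/la take_size.
by rewrite -st take_size => ->; rewrite nth_default // size_comp.
Qed.

Lemma Qcoeff_eq D E w : (forall j, 0 < j < size w -> D j = E j) -> Qcoeff D w = Qcoeff E w.
Proof.
move=> h; apply: eq_in_all => j; rewrite mem_iota => hj; rewrite h //.
by move: hj; clear; lia.
Qed.

Lemma comp_eq n D E : (forall j, 0 < j < n -> D j = E j) -> comp_of_des n D = comp_of_des n E.
Proof.
move=> h; rewrite /comp_of_des (_ : [seq d <- iota 1 n.-1 | D d] = [seq d <- iota 1 n.-1 | E d]) //.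
apply: eq_in_filter => j; rewrite mem_iota => hj; apply: h; move: hj; clear; lia.
Qed.

(** * Full classes and their dominant elements *)

Section Classes.
Variables (A : finType) (n : nat) (Des : A -> pred nat) (phi : nat -> A -> A).
Hypothesis Des_range : forall T d, Des T d -> 0 < d < n.
Hypothesis DE : is_dual_equivalence n Des phi.
Variable P : A -> seq nat.
Hypothesis LP : labelling n Des phi n P.
Notation full := (full_class n phi).
Notation dom := (dominant n Des phi).
Notation comp T := (comp_of_des n (Des T)).

Let sizeP T : size (P T) = n. Proof. by case: LP => h _ _ _ _; have [] := h T. Qed.
Let yamPP T : yam (P T). Proof. by case: LP => h _ _ _ _; have [] := h T. Qed.

Lemma full_sym T U : full T U = full U T. Proof. exact: cls_sym. Qed.

Lemma full_trans T U V : full T U -> full U V -> full T V. Proof. exact: cls_trans. Qed.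

Lemma compP T : comp T = comp_of_des n (wdes (P T)).
Proof. by case: LP => _ h _ _ _; apply: comp_eq => j; apply: h. Qed.

Lemma fullP T U : full T U -> perm_eq (P T) (P U).
Proof.
apply: (cls_ind DE (P := fun U => perm_eq (P T) (P U))) => // j V j2 jn pV.
rewrite (perm_trans pV) //; case: LP => _ _ h _ _; rewrite h ?jn ?andbT; last by case/andP: j2.
by rewrite perm_sym perm_dd.
Qed.

Lemma full_inj T U : full T U -> P T = P U -> T = U.
Proof. by case: LP => _ _ _ h _; apply: h. Qed.

Lemma full_surj T z : yam z -> perm_eq (P T) z -> exists2 U, full T U & P U = z.
Proof.
move=> yz pz; have [s hs es] := yam_connected (yamPP T) yz pz; rewrite sizeP in hs.
exists (act phi s T); last by case: LP => _ _ h _ _; rewrite (act_dact h).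
by apply: act_cls; apply: sub_all hs => i; clear; lia.
Qed.

Let top T := sort leq (P T).

Let topP T : [/\ yam (top T), sorted leq (top T), perm_eq (P T) (top T) & size (top T) = n].
Proof.
have yt : yam (top T) by apply/yam_sort/yam_partc.
split=> //; [exact: (sort_sorted leq_total) | by rewrite perm_sym perm_sort | by rewrite size_sort sizeP].
Qed.

Lemma dominant_top T : dom T = (P T == top T).
Proof.
have [yt st pt zt] := topP T; apply/idP/eqP => [/forallP h|e].
  have [U TU eU] := full_surj yt pt.
  have := h U; rewrite TU /= !compP eU -zt; exact: dominates_eq.
apply/forallP => S; apply/implyP => TS; rewrite !compP e -zt.
by apply: dominates_sorted => //; rewrite -(permPr pt) perm_sym fullP.
Qed.

Lemma dominant_ex T : exists2 U, full T U & dom U.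
Proof.
have [yt st pt zt] := topP T; have [U TU eU] := full_surj yt pt; exists U => //.
rewrite dominant_top eU /top -/(top T); apply/eqP.
by apply/(perm_sortP leq_total leq_trans anti_leq); rewrite eU.
Qed.

Lemma dominant_uniq U V : full U V -> dom U -> dom V -> U = V.
Proof.
rewrite !dominant_top => UV /eqP eU /eqP eV; apply: full_inj => //; rewrite eU eV.
by apply/(perm_sortP leq_total leq_trans anti_leq); apply: fullP.
Qed.

Lemma dominant_comp T : dom T -> is_partition n (comp T) /\ forall j, nth 0 (comp T) j = cnt j (P T).
Proof.
rewrite dominant_top => /eqP e; have [yt st pt zt] := topP T.
by have := comp_sorted yt st; rewrite zt -e compP.
Qed.

(** [P] maps the class bijectively onto the lattice words of one content and turns descents into
    ascents, so [schur_coeffE] applies. *)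
Lemma class_sum T w : monomial n w -> dom T ->
  \sum_(U | full T U) Qcoeff (Des U) w = schur_coeff (comp T) w.
Proof.
move=> /andP[sw /eqP zw] dT; have [pT cT] := dominant_comp dT.
rewrite (schur_coeffE sw (yamPP T)) ?zw ?sizeP //; last by case/andP: pT => _ /eqP.
have -> : count (fun v => perm_eq (P T) v && Qcoeff (wdes v) w) (allyam n)
    = sumn [seq (Qcoeff (wdes v) w : nat) | v <- [seq v <- allyam n | perm_eq (P T) v]].
  by rewrite sumn_countb count_filter; apply: eq_count => v /=; rewrite andbC.
have pe : perm_eq [seq v <- allyam n | perm_eq (P T) v] [seq P U | U <- enum (full T)].
  apply: uniq_perm; first by rewrite filter_uniq ?uniq_allyam.
    rewrite map_inj_in_uniq ?enum_uniq // => U V; rewrite !mem_enum => TU TV; apply: full_inj.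
    by apply: full_trans TV; rewrite full_sym.
  move=> v; rewrite mem_filter mem_allyam; apply/idP/mapP => [/andP[pv /andP[yv _]]|[U]].
    by have [U TU eU] := full_surj yv pv; exists U; rewrite ?mem_enum.
  by rewrite mem_enum => TU ->; rewrite fullP // yamPP sizeP eqxx.
rewrite (sumn_perm (perm_map _ pe)) -map_comp sumnE big_map big_enum.
apply: eq_bigr => U _ /=; congr nat_of_bool; apply: Qcoeff_eq => j; rewrite zw.
by case: LP => _ h _ _ _; apply: h.
Qed.
End Classes.

Theorem theorem4p6 (A : finType) (n : nat) (Des : A -> pred nat)
  (phi : nat -> A -> A) (r : nat) (stat : A -> r.-tuple nat) :
  (forall T d, Des T d -> 0 < d < n) ->
  is_dual_equivalence n Des phi ->
  (forall i T, 1 < i < n -> stat (phi i T) = stat T) ->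
  (* unique dominant element in each class *)
  (forall T : A, exists U, full_class n phi T U /\ dominant n Des phi U /\
      forall V, full_class n phi T V -> dominant n Des phi V -> V = U) /\
  (* alpha(T) is a partition for dominant T *)
  (forall T : A, dominant n Des phi T -> is_partition n (comp_of_des n (Des T))) /\
  (* the expansion, compared coefficientwise at q^s x^w *)
  (forall (s : r.-tuple nat) (w : seq nat), monomial n w ->
     \sum_(T | stat T == s) Qcoeff (Des T) w
       = \sum_(T | dominant n Des phi T && (stat T == s)) schur_coeff (comp_of_des n (Des T)) w
     /\
     \sum_(T | dominant n Des phi T && (stat T == s)) schur_coeff (comp_of_des n (Des T)) w
       = \sum_(la <- undup [seq comp_of_des n (Des T) | T <- enum A & dominant n Des phi T])
           (\sum_(T | [&& dominant n Des phi T, comp_of_des n (Des T) == la & stat T == s]) 1)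
             * schur_coeff la w).
Proof.
move=> Des_range DE stat_phi; have [P LP] := labelling_ex Des_range DE.
have stat_full T U : full_class n phi T U -> stat U = stat T.
  apply: (cls_ind DE (P := fun U => stat U = stat T)) => // j V j2 jn <-.
  by apply: stat_phi; case/andP: j2 => -> _.
split=> [T|].
  have [U TU dU] := dominant_ex DE LP T; exists U; split=> //; split=> // V TV dV.
  by apply: (dominant_uniq DE LP) => //; apply: full_trans TU; rewrite full_sym.
split=> [T /(dominant_comp DE LP)[]//|s w mw]; split.
  (* The sum is grouped by a chosen dominant element of each class; [stat] is constant on
     classes. *)
  have domT T : {U | full_class n phi T U && dominant n Des phi U}.
    by apply: sigW; have [U TU dU] := dominant_ex DE LP T; exists U; rewrite TU.
  rewrite (partition_big (fun T => sval (domT T)) (fun U => dominant n Des phi U && (stat U == s))) /=.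
    apply: eq_bigr => U /andP[dU /eqP sU]; rewrite -(class_sum DE LP mw dU).
    apply: eq_bigl => T; case: (domT T) => V /= /andP[TV dV].
    apply/andP/idP => [[_ /eqP <-]|UT]; first by rewrite full_sym.
    have VU : V = U.
      by apply: (dominant_uniq DE LP) => //; rewrite full_sym; apply: full_trans UT TV.
    by rewrite VU eqxx (stat_full _ _ UT) sU eqxx.
  by move=> T /eqP <-; case: (domT T) => V /= /andP[TV ->]; rewrite (stat_full _ _ TV) eqxx.
(* Each dominant [T] contributes to exactly one [la] of the duplicate-free list, so the two sums can
   be exchanged. *)
transitivity (\sum_(la <- undup [seq comp_of_des n (Des T) | T <- enum A & dominant n Des phi T])
   \sum_(T | dominant n Des phi T && (stat T == s))
      if comp_of_des n (Des T) == la then schur_coeff la w else 0).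
  rewrite exchange_big /=; apply: eq_bigr => T /andP[dT _].
  rewrite -big_mkcond /= (eq_bigl (pred1 (comp_of_des n (Des T)))); last by move=> la /=; rewrite eq_sym.
  rewrite -big_filter filter_pred1_uniq ?undup_uniq ?big_seq1 // mem_undup.
  by apply: map_f; rewrite mem_filter dT mem_enum.
apply: eq_bigr => la _; rewrite big_distrl /= -big_mkcondr /=.
by apply: eq_big => [T|T _]; rewrite ?mul1n // andbAC andbA.
Qed.
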